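(* Let $N\in\mathbb N$ and assume that $G\subset\mathcal P_{\le N}$ is a subgroup with $\max\{\deg P: P\in G\}=N$. Then $G$ is an $N$-rigidity group if and only if $G$ has finite index in $\mathcal P_{\le N}$.
   Context: $\mathbb N=\{1,2,\dots\}$. $\mathcal P_{\le N}$ is the additive group of polynomials $P\in\mathbb Z[x]$ with $P(0)=0$ and $\deg P\le N$. $\beta\mathbb N$ is the set of ultrafilters on $\mathbb N$, with addition defined by: $A\in p+q$ iff $\{n\in\mathbb N: A-n\in p\}\in q$, where $A-n=\{y\in\mathbb N: y+n\in A\}$; $p$ is idempotent if $p+p=p$. For a sequence $(x_n)$ in a topological space, $p\text{-}\lim_{n\in\mathbb N}x_n=x$ means that $\{n\in\mathbb N: x_n\in O\}\in p$ for every open neighbourhood $O$ of $x$; for bounded operators on a Hilbert space, $p$-limits are taken in the weak operator topology. Hilbert spaces are complex and separable. A subgroup $G\subset\mathcal P_{\le N}$ is called an $N$-rigidity group if there exist an idempotent $p\in\beta\mathbb N$ and a unitary operator $U$ on a Hilbert space $\mathcal H$ such that $G=\{P\in\mathcal P_{\le N}: p\text{-}\lim_{n\in\mathbb N}U^{P(n)}=Id\}$ and $p\text{-}\lim_{n\in\mathbb N}U^{Q(n)}=0$ for each $Q\in\mathcal P_{\le N}\setminus G$. *)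

(* Defs.v *)
From HB Require Import structures.
From mathcomp Require Import all_boot all_order all_algebra.
From mathcomp Require Import complex.
From mathcomp Require Import all_classical all_reals all_analysis.

Set Implicit Arguments.
Unset Strict Implicit.
Unset Printing Implicit Defensive.

Import Order.TTheory GRing.Theory Num.Theory.
Import numFieldNormedType.Exports.

Local Open Scope classical_set_scope.
Local Open Scope ring_scope.

Definition pnat : Type := {n : nat | (0 < n)%N}.

Definition addp (m n : pnat) : pnat :=
  exist _ (val m + val n)%N (ltn_addr (val n) (valP m)).

(* The order matters: (p + q) tests [A - n] with [p] and the shifts [n] with
   [q]. *)
Definition ultra_add (p q : set_system pnat) : set_system pnat :=
  [set A : set pnat | q [set n | p [set y | A (addp y n)]]].

Definition idempotent_ultrafilter (p : set_system pnat) : Prop :=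
  UltraFilter p /\ ultra_add p p = p.

Definition plim (T : topologicalType) (p : set_system pnat) (x : pnat -> T)
    (l : T) : Prop :=
  forall O : set T, open O -> O l -> p [set n | O (x n)].

(* The inner product is linear in its first argument and conjugate-linear in
   its second one. The zero space is allowed. *)
Record hilbertSpace (R : realType) := HilbertSpace {
  hilbert_sort :> completeNormedModType R[i];
  inner : {dot hilbert_sort for Num.conj};
  inner_normE : forall x : hilbert_sort, `|x| ^+ 2 = inner x x;
  hilbert_separable : exists2 S : set hilbert_sort, countable S & dense S
}.

Section BoundedOperators.
Variables (R : realType) (H : hilbertSpace R).

Record boundedOp := BoundedOp {
  op_fun :> {linear H -> H};
  op_bounded : exists2 M : R[i], 0 <= M & forall x, `|op_fun x| <= M * `|x|
}.

Fact id_bounded :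
  exists2 M : R[i], 0 <= M &
    forall x : H, `|(idfun : {linear H -> H}) x| <= M * `|x|.
Proof. by exists 1 => // x; rewrite mul1r. Qed.

Definition op_id : boundedOp := BoundedOp id_bounded.

Fact null_bounded :
  exists2 M : R[i], 0 <= M &
    forall x : H, `|(\0 : {linear H -> H}) x| <= M * `|x|.
Proof. by exists 0 => // x; rewrite mul0r normr0. Qed.

Definition op_zero : boundedOp := BoundedOp null_bounded.

Fact comp_bounded (S T : boundedOp) :
  exists2 M : R[i], 0 <= M &
    forall x : H, `|((S \o T) : {linear H -> H}) x| <= M * `|x|.
Proof.
have [M M0 SM] := op_bounded S; have [L L0 TL] := op_bounded T.
exists (M * L); first exact: mulr_ge0.
move=> x /=; apply: le_trans (SM _) _.
by rewrite -mulrA; apply: ler_wpM2l (TL x).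
Qed.

Definition op_comp (S T : boundedOp) : boundedOp :=
  BoundedOp (comp_bounded S T).

HB.instance Definition _ := gen_eqMixin boundedOp.
HB.instance Definition _ := gen_choiceMixin boundedOp.

(* The weak operator topology: the coarsest topology on the bounded operators
   making every T |-> <T x, y> continuous. *)
Definition wot : topologicalType :=
  @sup_topology boundedOp (H * H)%type (fun xy => Topological.class
    (@initial_topology boundedOp R[i]^o (fun T => inner H (T xy.1) xy.2))).

Record unitaryOp := UnitaryOp {
  unitary_op :> boundedOp;
  unitary_adj : boundedOp;
  unitary_adjP :
    forall x y : H, inner H (unitary_op x) y = inner H x (unitary_adj y);
  unitary_opK : cancel unitary_op unitary_adj;
  unitary_adjK : cancel unitary_adj unitary_op
}.

(* U^(-n) is the n-th power of the adjoint of U, which is the inverse of U. *)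
Definition unitary_pow (U : unitaryOp) (k : int) : boundedOp :=
  match k with
  | Posz n => iter n (op_comp U) op_id
  | Negz n => iter n.+1 (op_comp (unitary_adj U)) op_id
  end.

End BoundedOperators.

Definition intpolys (N : nat) : set {poly int} :=
  [set P | P.[0] = 0 /\ (size P <= N.+1)%N].

Definition subgroup_of (V : zmodType) (A G : set V) : Prop :=
  [/\ G `<=` A, G 0 & forall x y, G x -> G y -> G (x - y)].

Definition finite_index (V : zmodType) (A G : set V) : Prop :=
  finite_set [set C : set V | exists2 x, A x & C = [set x + g | g in G]].

Definition poly_wot_lim (R : realType) (H : hilbertSpace R)
    (p : set_system pnat) (U : unitaryOp H) (P : {poly int})
    (T : boundedOp H) : Prop :=
  plim p (fun n : pnat => unitary_pow U P.[(val n)%:Z] : wot H) (T : wot H).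

Definition rigidity_group (R : realType) (N : nat) (G : set {poly int}) : Prop :=
  subgroup_of (intpolys N) G /\
  exists (p : set_system pnat) (H : hilbertSpace R) (U : unitaryOp H),
    [/\ idempotent_ultrafilter p,
        G = [set P | intpolys N P /\ poly_wot_lim p U P (op_id H)] &
        forall Q, (intpolys N `\` G) Q -> poly_wot_lim p U Q (op_zero H)].

(* Main.v *)
Require Import Defs.
From HB Require Import structures.
From mathcomp Require Import all_boot all_order all_algebra.
From mathcomp Require Import generic_quotient ring_quotient complex.
From mathcomp Require Import all_classical all_reals all_analysis.
From mathcomp Require Import ring lra.
Import Defs.

(** Write P_N for the group of integer polynomials without constant term and
    of degree at most N.

    Necessity.  Let P in G have degree k + 1 >= 2, let the Hilbert space be
    nonzero and put D_n(y) = P(y + n) - P(n).  Since p = p + p, for some n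
    the operators U^P(y + n) = U^P(n) U^D_n(y) are weakly close to the
    identity for p-most y.  So the p-limit of U^D_n(y) is not 0 and D_n
    belongs to G ([rigid_shift]).  Then so does D_n - P, which has degree
    exactly k ([coef_shift_poly]).  Starting from degree N, one gets elements
    of G of all degrees 1, ..., N, and division of leading coefficients
    leaves finitely many cosets ([finite_representatives]).

    Sufficiency.  If G has finite index, some d >= 1 satisfies d P_N <= G.
    Let Gamma be the countable group of finitely supported sequences of
    integer polynomials modulo the sequences with all terms in G.  On
    l2(Gamma) the translations T_g tend weakly to 0 as g leaves every finite
    set ([c0_representation]).  Let g(k, i) be the class of the sequence with
    x^i at position k and 0 elsewhere.  The unitary T_g(k, i) has order
    dividing d, so it has a spectral decomposition over the d-th roots of
    unity and lies on a one-parameter unitary group h |-> T_g(k, i)^h of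
    period d ([root_flow]).  For a fast growing sequence n_k put

      U(t) = product over k and 1 <= j <= N of T_g(k, j)^(t / n_k^j),

    which converges in norm because the factors are O(t / n_k) close to the
    identity ([infinite_product_flow]).  For a finite set F of indices let
    n_F be the sum of the n_k with k in F.  The divisibility and growth
    properties of n_k give, modulo d and up to an error 2^-k,

      n_F^i / n_k^j = 1 if k is in F and i = j, and 0 otherwise

    ([fsum_pow]).  Hence U(n_F^i) is O(2^-(min F)) close to the translation by
    the sum of g(k, i) over k in F ([exists_flow]), and U(Q(n_F)) is close to
    the translation by the class of the sequence equal to Q on F and to 0
    elsewhere.  This class is trivial if Q is in G; otherwise it leaves every
    finite subset of Gamma as min F tends to infinity ([coef_class_avoid]).
    So U = U(1) has the required limits along every idempotent ultrafilter
    that contains, for each m, the set of the sums n_F with min F >= m.  Such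
    an ultrafilter exists because these sets generate a closed subsemigroup of
    the Stone-Cech compactification, and a compact right topological semigroup
    contains an idempotent ([idempotent_ultrafilter_exists]). *)

Set Implicit Arguments.
Unset Strict Implicit.
Unset Printing Implicit Defensive.

Import Order.TTheory GRing.Theory Num.Theory.
Import numFieldNormedType.Exports.

Local Open Scope classical_set_scope.
Local Open Scope ring_scope.
Local Open Scope complex_scope.

(** * Idempotent ultrafilters *)

Lemma addpA m n k : addp (addp m n) k = addp m (addp n k).
Proof. by apply: val_inj; rewrite /= addnA. Qed.

Lemma ultra_addA p q r :
  ultra_add (ultra_add p q) r = ultra_add p (ultra_add q r).
Proof.
apply/funext => A; rewrite /ultra_add /mkset.
congr (r _); apply/funext => n; congr (q _); apply/funext => m.
by congr (p _); apply/funext => y; rewrite addpA.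
Qed.

Lemma ultra_setC T (p : set_system T) (A : set T) :
  UltraFilter p -> p (~` A) <-> ~ p A.
Proof.
move=> pU; split=> [pcA pA|npA]; last by have [/npA|] := in_ultra_setVsetC A pU.
have [x []] : (A `&` ~` A) !=set0 by apply: (@filter_ex _ p); exact: filterI.
by [].
Qed.

Lemma ultra_of_dichotomy T (p : set_system T) : ProperFilter p ->
  (forall A, p A \/ p (~` A)) -> UltraFilter p.
Proof.
move=> pP h; split=> // G GP pG; apply/seteqP; split=> // A GA.
case: (h A) => // /pG GcA.
by have [x []] : (A `&` ~` A) !=set0 by apply: (@filter_ex _ G); exact: filterI.
Qed.

Lemma ultra_add_proper p q :
  ProperFilter p -> ProperFilter q -> ProperFilter (ultra_add p q).
Proof.
move=> pP qP; split.
  rewrite /ultra_add /mkset => q0; have [n pn] := filter_ex q0.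
  by have [y] := filter_ex pn.
split; rewrite /ultra_add /mkset.
- by apply: filterE => n; exact: filterE.
- by move=> A B qA qB; apply: filterS (filterI qA qB) => n [pA pB]; exact: filterI.
- by move=> A B AB; apply: filterS => n /=; apply: filterS => y; exact: AB.
Qed.

Lemma ultra_add_ultra p q :
  UltraFilter p -> UltraFilter q -> UltraFilter (ultra_add p q).
Proof.
move=> pU qU; apply: ultra_of_dichotomy; first exact: ultra_add_proper.
move=> A; rewrite /ultra_add /mkset.
have [qA|qA] := in_ultra_setVsetC [set n | p [set y | A (addp y n)]] qU.
  by left.
right; apply: filterS qA => n npA.
exact/(ultra_setC [set y | A (addp y n)]).
Qed.

(** A filter is the intersection of the ultrafilters that contain it, so that
    a closed set can be recovered from its points. *)
Lemma filter_ultra_mem T (F : set_system T) (A : set T) : ProperFilter F ->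
  (forall u, UltraFilter u -> F `<=` u -> u A) -> F A.
Proof.
move=> FP h; apply: contrapT => nFA.
pose G := filter_from F (fun B => B `&` ~` A).
have GP : ProperFilter G.
  apply: filter_from_proper.
    apply: filter_from_filter; first by exists setT; exact: filterT.
    move=> B C FB FC; exists (B `&` C); first exact: filterI.
    by move=> x [[? ?] ?].
  move=> B FB; apply: contrapT => h0; apply: nFA; apply: filterS FB => x Bx.
  by apply: contrapT => nAx; apply: h0; exists x.
have [u [uU Gu]] := ultraFilterLemma GP.
have /ultra_setC : u (~` A).
  by apply: Gu; exists setT; [exact: filterT|move=> x []].
apply; apply: h => // B FB; apply: Gu; exists B => //; by move=> x [].
Qed.

Lemma filter_meet_ultra T (F G : set_system T) : Filter F -> Filter G ->
  (forall A B, F A -> G B -> A `&` B !=set0) ->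
  exists u, [/\ UltraFilter u, F `<=` u & G `<=` u].
Proof.
move=> FF GF FG.
pose H := filter_from [set AB : set T * set T | F AB.1 /\ G AB.2]
   (fun AB => AB.1 `&` AB.2).
have HP : ProperFilter H.
  apply: filter_from_proper; last by move=> [A B] [/= FA GB]; exact: FG.
  apply: filter_from_filter; first by exists (setT, setT); split; exact: filterT.
  move=> [A B] [A' B'] [/= FA GB] [/= FA' GB'].
  exists (A `&` A', B `&` B'); first by split; exact: filterI.
  by move=> x [[? ?] [? ?]].
have [u [uU Hu]] := ultraFilterLemma HP.
exists u; split=> // A FA; apply: Hu.
  by exists (A, setT); [split=> //; exact: filterT|move=> x []].
by exists (setT, A); [split=> //; exact: filterT|move=> x []].
Qed.

(** A filter F stands for the nonempty closed set of the ultrafilters that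
    contain it; the second condition says that this set is a subsemigroup. *)
Definition closed_semigroup (F : set_system pnat) : Prop :=
  ProperFilter F /\ forall u v, UltraFilter u -> UltraFilter v ->
    F `<=` u -> F `<=` v -> F `<=` ultra_add u v.

(** As q |-> p + q is continuous, the image of the compact set of the
    ultrafilters containing F is closed, and [ultra_add p F] is its filter. *)
Lemma ultra_add_factor (F p u : set_system pnat) :
  ProperFilter F -> UltraFilter p -> UltraFilter u -> ultra_add p F `<=` u ->
  exists q, [/\ UltraFilter q, F `<=` q & u = ultra_add p q].
Proof.
move=> FP pU uU Fu.
have [q [qU Fq qu]] : exists q, [/\ UltraFilter q, F `<=` q &
    [set A | exists2 B, u B & [set n | p [set y | B (addp y n)]] `<=` A] `<=` q].
  apply: filter_meet_ultra.
    split; first by exists setT; [exact: filterT|].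
      move=> A B [A' uA' AA'] [B' uB' BB'].
      exists (A' `&` B'); first exact: filterI.
      by move=> n /= pn; split; [apply: AA'|apply: BB']; apply: filterS pn => y [].
    by move=> A B AB [A' uA' A'A]; exists A' => //; exact: subset_trans AB.
  move=> A B FA [B' uB' B'B]; apply: contrapT => h0.
  have : u (~` B').
    apply: Fu; rewrite /ultra_add /mkset; apply: filterS FA => n An.
    by apply/ultra_setC => pB'; apply: h0; exists n; split=> //; exact: B'B.
  by move/ultra_setC.
exists q; split=> //; apply: esym; apply: (@max_filter _ u uU).
  by have [] := ultra_add_ultra pU qU.
by move=> B uB; apply: qu; exists B.
Qed.

(** If S is a closed subsemigroup and p is in S, then p + S is a closed
    subsemigroup contained in S. *)
Lemma translate_closed_semigroup (F p : set_system pnat) :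
  closed_semigroup F -> UltraFilter p -> F `<=` p ->
  closed_semigroup (ultra_add p F) /\ F `<=` ultra_add p F.
Proof.
move=> [FP Fsg] pU Fp.
have Fsub : F `<=` ultra_add p F.
  move=> A FA; rewrite /ultra_add /mkset; apply: filter_ultra_mem => u uU Fu.
  exact: (Fsg p u).
have F'P := ultra_add_proper (@ultra_proper _ _ pU) FP.
split=> //; split=> // u v uU vU F'u F'v.
have [q [qU Fq ->]] := ultra_add_factor FP pU uU F'u.
rewrite ultra_addA => A F'A; apply: (Fsg q v qU vU Fq (subset_trans Fsub F'v)).
exact: F'A.
Qed.

(** If S is a closed subsemigroup and p is in S, then the q in S with
    p + q = p form a closed subsemigroup, as soon as there is one. *)
Lemma stabilizer_closed_semigroup (F p q : set_system pnat) :
  closed_semigroup F -> UltraFilter p -> F `<=` p ->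
  UltraFilter q -> F `<=` q -> ultra_add p q = p ->
  exists F', [/\ closed_semigroup F', F `<=` F' &
    forall A, p A -> F' [set n | p [set y | A (addp y n)]]].
Proof.
move=> [FP Fsg] pU Fp qU Fq pq.
pose I := [set X : set pnat * set pnat | F X.1 /\ p X.2].
pose D (X : set pnat * set pnat) := X.1 `&` [set n | p [set y | X.2 (addp y n)]].
pose F' := filter_from I D.
have F'q : F' `<=` q.
  move=> A [[X Y] [/= FX pY] XYA]; apply: (@filterS _ q _ _ _ XYA).
  apply: filterI; first exact: Fq.
  by move: pY; rewrite -{1}pq.
have F'P : ProperFilter F'.
  apply: filter_from_proper; last first.
    move=> X IX; apply: (@filter_ex _ q); apply: F'q; by exists X.
  apply: filter_from_filter.
    by exists (setT, setT); split; exact: filterT.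
  move=> [A B] [A' B'] [/= FA GB] [/= FA' GB'].
  exists (A `&` A', B `&` B'); first by split; exact: filterI.
  move=> x [[? ?] /= h]; do !split=> //=; apply: filterS h => y []//.
have FF' : F `<=` F'.
  move=> A FA; exists (A, setT); first by split=> //; exact: filterT.
  by move=> x [].
have pF' A : p A -> F' [set n | p [set y | A (addp y n)]].
  by move=> pA; exists (setT, A); [split=> //; exact: filterT|move=> x []].
exists F'; split=> //; split=> // u v uU vU F'u F'v.
have pstab w : UltraFilter w -> F' `<=` w -> ultra_add p w = p.
  move=> wU F'w; apply: (@max_filter _ p pU).
    by have [] := ultra_add_ultra pU wU.
  by move=> A pA; apply: F'w; exact: pF'.
have uvU := ultra_add_ultra uU vU.
have Fuv : F `<=` ultra_add u v.
  by apply: Fsg => //; exact: subset_trans FF' _.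
have puv : ultra_add p (ultra_add u v) = p.
  by rewrite -ultra_addA !pstab.
move=> A [[X Y] [/= FX pY] XYA]; apply: (filterS XYA).
apply: filterI; first exact: Fuv.
by move: pY; rewrite -{1}puv.
Qed.

(** Smaller closed sets correspond to larger filters: this is the existence of
    a minimal closed subsemigroup. *)
Lemma maximal_closed_semigroup (F0 : set_system pnat) :
  closed_semigroup F0 -> exists F, [/\ closed_semigroup F, F0 `<=` F &
    forall F', closed_semigroup F' -> F `<=` F' -> F' = F].
Proof.
move=> F0sg.
pose good F := closed_semigroup F /\ F0 `<=` F.
have [] := @Zorn_bigcup (set pnat) [set F | F = set0 \/ good F].
  move=> /= C Csub Ctot.
  have [[F1 CF1 [F1sg F01]]|nC] := pselect (exists2 F1, C F1 & good F1); last first.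
    left; rewrite -subset0 => A [F CF FA]; case: (Csub _ CF) => [F0'|gF].
      by rewrite F0' in FA.
    by exfalso; apply: nC; exists F.
  right.
  have Cgood F A : C F -> F A -> good F.
    by move=> CF FA; case: (Csub _ CF) => // F0'; rewrite F0' in FA.
  have [F1P _] := F1sg.
  split; last by move=> A /F01 F1A; exists F1.
  split.
    split.
      move=> [F CF FA]; have [[[n0 _] _] _] := Cgood _ _ CF FA.
      exact: n0.
    split.
    - by exists F1 => //; exact: filterT.
    - move=> A B [F CF FA] [F' CF' F'B].
      have [[FP _] _] := Cgood _ _ CF FA; have [[F'P _] _] := Cgood _ _ CF' F'B.
      have [FF'|F'F] := Ctot _ _ CF CF'.
        by exists F' => //; apply: filterI => //; exact: FF'.
      by exists F => //; apply: filterI => //; exact: F'F.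
    - move=> A B AB [F CF FA]; have [[FP _] _] := Cgood _ _ CF FA.
      by exists F => //; exact: filterS AB _.
  move=> u v uU vU Fu Fv A [F CF FA].
  have [[_ Fsg] _] := Cgood _ _ CF FA.
  by apply: (Fsg u v uU vU) => // B FB; [apply: Fu|apply: Fv]; exists F.
move=> F [gF Fmax].
have {gF} [F0'|[Fsg F0F]] := gF.
  exfalso; apply: (Fmax F0); last by right; split.
  rewrite F0'; split; first exact: sub0set.
  have [F0P _] := F0sg; move=> /(_ setT); apply.
  exact: filterT.
exists F; split=> // F' F'sg FF'; apply: contrapT => ne.
apply: (Fmax F'); last by right; split=> //; exact: subset_trans FF'.
by split=> // F'F; apply: ne; apply/seteqP.
Qed.

(** The argument of Ellis.  A minimal closed subsemigroup S is equal to p + S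
    for each of its points p; so p = p + q for some q in S, and by minimality
    every point of S stabilizes p, in particular p itself. *)
Theorem idempotent_ultrafilter_exists (B : nat -> set pnat) :
  (forall m, B m !=set0) -> (forall m n, (m <= n)%N -> B n `<=` B m) ->
  (forall m n, B m n -> exists m', forall y, B m' y -> B m (addp y n)) ->
  exists p, idempotent_ultrafilter p /\ forall m, p (B m).
Proof.
move=> B0 Bdec Badd.
pose F0 := filter_from [set: nat] B.
have F0sg : closed_semigroup F0.
  split.
    apply: filter_from_proper; last by move=> m _; exact: B0.
    apply: filter_from_filter; first by exists 0%N.
    move=> i j _ _; exists (maxn i j) => //.
    by move=> x Bx; split; apply: (Bdec _ _ _ _ Bx); rewrite ?leq_maxl ?leq_maxr.
  move=> u v uU vU F0u F0v A [m _ BA]; rewrite /ultra_add /mkset.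
  have vB : v (B m) by apply: F0v; exists m.
  apply: filterS vB => n /Badd[m' Bm'].
  have uB : u (B m') by apply: F0u; exists m'.
  by apply: filterS uB => y /= /Bm' /BA.
have [F [Fsg F0F Fmax]] := maximal_closed_semigroup F0sg.
have [FP _] := Fsg.
have [p [pU Fp]] := ultraFilterLemma FP.
have [tsg Ft] := translate_closed_semigroup Fsg pU Fp.
have tF := Fmax _ tsg Ft.
(* minimality gives p + S = S, which contains p *)
have [q [qU Fq pq]] : exists q, [/\ UltraFilter q, F `<=` q & p = ultra_add p q].
  by apply: ultra_add_factor => //; rewrite tF.
(* minimality again: the stabilizer of p in S is all of S *)
have [F' [F'sg FF' pF']] := stabilizer_closed_semigroup Fsg pU Fp qU Fq (esym pq).
have F'F := Fmax _ F'sg FF'; subst F'.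
exists p; split; last by move=> m; apply: Fp; apply: F0F; exists m.
split=> //; apply: (@max_filter _ p pU).
  by have [] := ultra_add_ultra pU pU.
by move=> A /pF' /Fp.
Qed.

(** * Sums over a countable type *)

Section CountableSums.
Variables (R : realType) (I : countType).
Local Notation C := R[i].
Local Notation normc := (@Normc.normc R).
Local Notation Re := (@complex.Re R).
Local Notation Im := (@complex.Im R).

(** Sums over the type are limits of sums over these lists, which exhaust it. *)
Definition initial n : seq I := pmap pickle_inv (iota 0 n).

Lemma mem_initial g n : (g \in initial n) = (pickle g < n)%N.
Proof.
rewrite mem_pmap; apply/mapP/idP => [[i ii e] | ltgn].
  move: ii; rewrite mem_iota /= add0n => ltin.
  by have := pickle_invK (T := I) i; rewrite -e /= => ->.
by exists (pickle g); [rewrite mem_iota|rewrite pickleK_inv].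
Qed.

Lemma initial_uniq n : uniq (initial n).
Proof. by apply: pmap_uniq (iota_uniq 0 n); exact: pickle_invK. Qed.

Lemma sub_initial (s : seq I) : exists n, {subset s <= initial n}.
Proof.
elim: s => [|g s [n sn]]; first by exists 0%N.
exists (maxn (pickle g).+1 n) => h; rewrite inE => /predU1P[->|/sn].
  by rewrite mem_initial leq_max ltnSn.
by rewrite !mem_initial leq_max => ->; rewrite orbT.
Qed.

Lemma ler_sum_sub (s t : seq I) (a : I -> R) : uniq s -> uniq t ->
  {subset s <= t} -> (forall g, 0 <= a g) ->
  \sum_(g <- s) a g <= \sum_(g <- t) a g.
Proof.
move=> us ut st a0.
rewrite [leRHS](bigID (mem s)) /= -[X in _ <= X + _]big_filter.
rewrite [X in _ <= X + _](perm_big s) /=; last first.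
  apply: uniq_perm; rewrite ?filter_uniq// => g.
  by rewrite mem_filter; apply/andb_idr/st.
by rewrite lerDl sumr_ge0.
Qed.

Definition absolutely_bounded (a : I -> C) (M : R) :=
  forall n, \sum_(g <- initial n) normc (a g) <= M.

Definition rtot (a : I -> R) : R := limn (fun n => \sum_(g <- initial n) a g).

Lemma nonneg_cvg (a : I -> R) (M : R) : (forall g, 0 <= a g) ->
  (forall n, \sum_(g <- initial n) a g <= M) ->
  cvgn (fun n => \sum_(g <- initial n) a g).
Proof.
move=> a0 aM; apply: nondecreasing_is_cvgn; last first.
  by exists M => _ [n _ <-]; exact: aM.
move=> m n mn; apply: ler_sum_sub; rewrite ?initial_uniq// => g.
by rewrite !mem_initial => /leq_trans; apply.
Qed.

(** A real family is the difference of the nonnegative families a + |a| and |a|. *)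
Lemma abs_cvg (a : I -> R) (M : R) :
  (forall n, \sum_(g <- initial n) `|a g| <= M) ->
  cvgn (fun n => \sum_(g <- initial n) a g).
Proof.
move=> aM.
have c1 : cvgn (fun n => \sum_(g <- initial n) `|a g|).
  exact: nonneg_cvg aM.
have c2 : cvgn (fun n => \sum_(g <- initial n) (a g + `|a g|)).
  apply: (@nonneg_cvg _ (M + M)) => [g|n].
    by rewrite -lerBlDl sub0r -normrN ler_norm.
  rewrite big_split /= lerD//; apply: le_trans (aM n); apply: ler_sum => g _.
  exact: ler_norm.
have -> : (fun n => \sum_(g <- initial n) a g) =
  (fun n => \sum_(g <- initial n) (a g + `|a g|)) -
  (fun n => \sum_(g <- initial n) `|a g|).
  apply/funext => n; rewrite !fctE -sumrB; apply: eq_bigr => g _.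
  by rewrite addrK.
exact: is_cvgB.
Qed.

(** Finite sums over arbitrary sets of indices are dominated by the total, so
    that for nonnegative families the total does not depend on the enumeration. *)
Lemma rtot_ge (a : I -> R) M (s : seq I) : (forall g, 0 <= a g) ->
  (forall n, \sum_(g <- initial n) a g <= M) -> uniq s ->
  \sum_(g <- s) a g <= rtot a.
Proof.
move=> a0 aM us; have [n sn] := sub_initial s.
apply: (@le_trans _ _ (\sum_(g <- initial n) a g)).
  by apply: ler_sum_sub; rewrite ?initial_uniq.
apply: limr_ge; first exact: nonneg_cvg aM.
exists n => //= m nm; apply: ler_sum_sub; rewrite ?initial_uniq// => g.
by rewrite !mem_initial => /leq_trans; apply.
Qed.

Lemma rtot_le (a : I -> R) M : (forall g, 0 <= a g) ->
  (forall n, \sum_(g <- initial n) a g <= M) -> rtot a <= M.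
Proof.
move=> a0 aM; apply: limr_le; first exact: nonneg_cvg aM.
by apply: nearW => n; exact: aM.
Qed.

Lemma normc_ge_abs (z : C) : (`|Re z| <= normc z) /\ (`|Im z| <= normc z).
Proof.
case: z => x y /=; split; rewrite -sqrtr_sqr ler_wsqrtr//.
  by rewrite lerDl sqr_ge0.
by rewrite lerDr sqr_ge0.
Qed.

Lemma eq_limn (u v : nat -> R) : u =1 v -> limn u = limn v.
Proof. by move/funext => ->. Qed.

Lemma addcE (x y x' y' : R) :
  (x +i* y) + (x' +i* y') = (x + x') +i* (y + y') :> C.
Proof. by []. Qed.

Lemma mulcE (x y x' y' : R) :
  (x +i* y) * (x' +i* y') = (x * x' - y * y') +i* (x * y' + y * x') :> C.
Proof. by []. Qed.

Definition ctot (a : I -> C) : C :=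
  rtot (fun g => Re (a g)) +i* rtot (fun g => Im (a g)).

Lemma ctot_cvg a M : absolutely_bounded a M ->
  cvgn (fun n => \sum_(g <- initial n) Re (a g)) /\
  cvgn (fun n => \sum_(g <- initial n) Im (a g)).
Proof.
move=> aM; split; apply: (@abs_cvg _ M) => n; apply: le_trans (aM n);
  by apply: ler_sum => g _; have [] := normc_ge_abs (a g).
Qed.

Lemma ctotD a b M L : absolutely_bounded a M -> absolutely_bounded b L ->
  ctot (fun g => a g + b g) = ctot a + ctot b.
Proof.
move=> /ctot_cvg[ra ia] /ctot_cvg[rb ib]; rewrite /ctot /rtot.
rewrite addcE.
congr (_ +i* _); rewrite -limD//; apply: eq_limn => n;
  by rewrite !fctE -big_split; apply: eq_bigr => g _; case: (a g) (b g) => ? ? [].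
Qed.

Lemma ctotZ c a M : absolutely_bounded a M ->
  ctot (fun g => c * a g) = c * ctot a.
Proof.
move=> /ctot_cvg[ra ia]; rewrite /ctot /rtot; case: c => x y.
have lZ (u : nat -> R) k : cvgn u -> limn (fun n => k * u n) = k * limn u.
  by move=> cu; apply: (cvg_lim (@Rhausdorff R)); apply: cvgM cu; exact: cvg_cst.
have cZ (u : nat -> R) k : cvgn u -> cvgn (fun n => k * u n).
  by move=> cu; apply/cvg_ex; exists (k * limn u); apply: cvgM => //; exact: cvg_cst.
rewrite mulcE.
congr (_ +i* _).
  rewrite -!lZ// -limB; [|exact: cZ|exact: cZ].
  apply: eq_limn => n; rewrite !fctE 2!mulr_sumr -sumrB.
  by apply: eq_bigr => g _; case: (a g) => ? ?.
rewrite -!lZ// -limD; [|exact: cZ|exact: cZ].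
apply: eq_limn => n; rewrite !fctE /= 2!mulr_sumr -big_split.
by apply: eq_bigr => g _; case: (a g) => ? ?.
Qed.

Lemma ctot_conj a M : absolutely_bounded a M ->
  ctot (fun g => (a g)^*) = (ctot a)^*.
Proof.
move=> /ctot_cvg[ra ia]; rewrite /ctot /rtot /=; congr (_ +i* _).
  by apply: eq_limn => n; apply: eq_bigr => g _; case: (a g).
rewrite -limN//.
apply: eq_limn => n; rewrite !fctE -sumrN.
by apply: eq_bigr => g _; case: (a g).
Qed.

End CountableSums.

(** * The space of square-summable functions *)

Section SquaredModulus.
Variable R : realType.
Local Notation C := R[i].
Local Notation normc := (@Normc.normc R).
Local Notation Re := (@complex.Re R).
Local Notation Im := (@complex.Im R).

Definition nsq (z : C) : R := Re z ^+ 2 + Im z ^+ 2.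

Lemma nsq_ge0 z : 0 <= nsq z.
Proof. by rewrite addr_ge0 ?sqr_ge0. Qed.

Lemma nsq0 : nsq 0 = 0.
Proof. by rewrite /nsq /= expr0n /= addr0. Qed.

Lemma nsqM y z : nsq (y * z) = nsq y * nsq z.
Proof. by case: y z => [a b] [c d]; rewrite mulcE /nsq /=; ring. Qed.

Lemma nsqD y z : nsq (y + z) <= 2 * nsq y + 2 * nsq z.
Proof.
case: y z => [a b] [c d]; rewrite addcE /nsq /=.
have := sqr_ge0 (a - c); have := sqr_ge0 (b - d); rewrite !expr2; nra.
Qed.

Lemma normc_nsq z : normc z = Num.sqrt (nsq z).
Proof. by case: z. Qed.

Lemma nsq_eq0 z : nsq z = 0 -> z = 0.
Proof.
case: z => x y; rewrite /nsq /= => /eqP; rewrite paddr_eq0 ?sqr_ge0//.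
by rewrite !sqrf_eq0 => /andP[/eqP-> /eqP->].
Qed.

Lemma mul_conj_nsq z : z * z^* = (nsq z)%:C.
Proof.
case: z => a b; rewrite mulcE /nsq /= /real_complex_def.
by congr (_ +i* _); ring.
Qed.

Lemma normc_mul_conj y z : normc (y * z^*) <= nsq y + nsq z.
Proof.
have hz : nsq z^* = nsq z by case: z => a b; rewrite /nsq /= sqrrN.
rewrite normc_nsq nsqM hz.
have y0 := nsq_ge0 y; have z0 := nsq_ge0 z.
have s0 : 0 <= nsq y + nsq z by rewrite addr_ge0.
rewrite -[leRHS]ger0_norm// -sqrtr_sqr ler_wsqrtr// expr2; nra.
Qed.

End SquaredModulus.

Section L2.
Variables (R : realType) (I : countType).
Local Notation C := R[i].
Local Notation Re := (@complex.Re R).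
Local Notation Im := (@complex.Im R).
Local Notation initial := (@initial I).
Local Notation ctot := (@ctot R I).
Local Notation rtot := (@rtot R I).

Definition sq_bounded (f : I -> C^o) (M : R) :=
  forall n, \sum_(g <- initial n) nsq (f g) <= M.

Definition sq_summable : {pred I -> C^o} :=
  fun f => `[< exists M, sq_bounded f M >].

Lemma sq_summable_submod : submod_closed sq_summable.
Proof.
split.
  apply/asboolP; exists 0 => n; rewrite big1// => g _.
  exact: nsq0.
move=> c f h /asboolP[M fM] /asboolP[L hL]; apply/asboolP.
exists (2 * nsq c * M + 2 * L) => n.
apply: (@le_trans _ _
  (\sum_(g <- initial n) (2 * nsq c * nsq (f g) + 2 * nsq (h g)))).
  apply: ler_sum => g _; apply: le_trans (nsqD _ _) _.
  by rewrite nsqM mulrA.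
rewrite big_split /= -!mulr_sumr lerD// ler_wpM2l//.
by rewrite mulr_ge0// nsq_ge0.
Qed.

HB.instance Definition _ :=
  GRing.isSubmodClosed.Build C (I -> C^o) sq_summable sq_summable_submod.

Record l2 := L2 { l2_fun :> I -> C^o; l2_funP : l2_fun \in sq_summable }.

HB.instance Definition _ := [isSub for l2_fun].
HB.instance Definition _ := [Choice of l2 by <:].
HB.instance Definition _ := [SubChoice_isSubLmodule of l2 by <:].

Lemma l2_bounded (f : l2) : exists M, sq_bounded f M.
Proof. exact/asboolP/l2_funP. Qed.

Lemma l2DE (f h : l2) g : (f + h) g = f g + h g.
Proof. by []. Qed.

Lemma l2NE (f : l2) g : (- f) g = - f g.
Proof. by []. Qed.

Lemma l2ZE c (f : l2) g : (c *: f) g = c * f g.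
Proof. by []. Qed.

Lemma l2_ext (f h : l2) : (forall g, f g = h g) -> f = h.
Proof. by move=> e; apply: val_inj; apply/funext. Qed.

Definition l2dot (f h : l2) : C := ctot (fun g => f g * (h g)^*).

Lemma l2dot_bounded (f h : l2) :
  exists M, absolutely_bounded (fun g => f g * (h g)^*) M.
Proof.
have [M fM] := l2_bounded f; have [L hL] := l2_bounded h.
exists (M + L) => n.
apply: (@le_trans _ _ (\sum_(g <- initial n) (nsq (f g) + nsq (h g)))).
  by apply: ler_sum => g _; exact: normc_mul_conj.
by rewrite big_split /= lerD.
Qed.

Lemma l2dotC f h : l2dot f h = (l2dot h f)^*.
Proof.
have [M hM] := l2dot_bounded h f.
rewrite /l2dot -(ctot_conj hM); congr (ctot _); apply/funext => g.
by rewrite rmorphM /= conjcK mulrC.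
Qed.

Lemma l2dot_conj f h : l2dot f h = Num.conj (l2dot h f).
Proof. exact: l2dotC. Qed.

Lemma l2dot_linearl h : GRing.linear_for *%R (l2dot^~ h).
Proof.
move=> c f f'.
have [M fM] := l2dot_bounded f h; have [L fL] := l2dot_bounded f' h.
rewrite /l2dot -(ctotZ c fM).
have [K cK] := l2dot_bounded (c *: f) h.
have cK' : absolutely_bounded (fun g => c * (f g * (h g)^*)) K.
  by move=> n; under eq_bigr do rewrite mulrA; exact: cK.
rewrite -(ctotD cK' fL); congr (ctot _); apply/funext => g.
by rewrite l2DE l2ZE mulrDl mulrA.
Qed.

Lemma l2dot_linearr f : GRing.linear_for (Num.conj \; *%R) (l2dot f).
Proof.
move=> c h h'; rewrite l2dot_conj l2dot_linearl rmorphD rmorphM /=.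
by rewrite -!l2dot_conj.
Qed.

Definition l2sq (f : l2) : R := rtot (fun g => nsq (f g)).

Lemma l2dotE f : l2dot f f = (l2sq f)%:C.
Proof.
rewrite /l2dot /ctot /l2sq /real_complex_def; congr (_ +i* _).
  by congr rtot; apply/funext => g; rewrite mul_conj_nsq.
rewrite /rtot (_ : (fun n => _) = cst 0) ?lim_cst//.
by apply/funext => n /=; rewrite big1// => g _; rewrite mul_conj_nsq.
Qed.

Lemma l2sq_ge (f : l2) (s : seq I) : uniq s ->
  \sum_(g <- s) nsq (f g) <= l2sq f.
Proof.
have [M fM] := l2_bounded f.
by move=> us; apply: (rtot_ge (M := M)) => // g; exact: nsq_ge0.
Qed.

Lemma l2sq_le (f : l2) M : sq_bounded f M -> l2sq f <= M.
Proof. by move=> fM; apply: rtot_le => // g; exact: nsq_ge0. Qed.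

Lemma l2sq_ge0 f : 0 <= l2sq f.
Proof. by have := @l2sq_ge f [::] isT; rewrite big_nil. Qed.

Lemma l2sq_gt0 f : f != 0 -> 0 < l2sq f.
Proof.
move=> f0; rewrite lt_neqAle l2sq_ge0 andbT; apply: contra f0 => /eqP s0.
apply/eqP/l2_ext => g; apply: nsq_eq0; apply/eqP.
rewrite eq_le nsq_ge0 andbT s0.
by have := @l2sq_ge f [:: g] isT; rewrite big_seq1.
Qed.

HB.instance Definition _ := bilinear_isBilinear.Build C l2 l2 C
  ( *%R ) (Num.conj \; *%R) l2dot (conj l2dot_linearl l2dot_linearr).

End L2.

(** * Norm and completeness of l2 *)

Section CauchySchwarz.
Variables (C : numClosedFieldType) (U : lmodType C).
Variable form : {dot U for Num.conj}.

(** The vector w = u - a v with a = <u, v> / <v, v> is orthogonal to v, hence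
    <u, u> >= |a|^2 <v, v>. *)
Lemma dot_CauchySchwarz u v : `|form u v| ^+ 2 <= form u u * form v v.
Proof.
have [->|v0] := eqVneq v 0.
  by rewrite linear0r normr0 expr0n /= linear0r mulr0.
have v_gt0 : 0 < form v v by rewrite dnorm_gt0.
pose a := form u v / form v v; pose w := u - a *: v.
have wv : form w v = 0.
  by rewrite linearBl/= linearZl_LR /= divfK ?subrr// gt_eqF.
have uE : form u u = form w w + `|a| ^+ 2 * form v v.
  rewrite (canRL (subrK _) (erefl w)) hnormDd/= ?dnormZ//.
  by rewrite linearZr_LR/= wv mulr0.
have -> : form u v = a * form v v by rewrite divfK// gt_eqF.
rewrite normrM exprMn [`|form v v|]gtr0_norm// uE mulrDl -[leLHS]add0r.
rewrite lerD ?mulr_ge0 ?dnorm_ge0//.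
by rewrite [form v v ^+ 2]expr2 mulrA.
Qed.

Lemma dot_CauchySchwarz_sqrt u v :
  `|form u v| <= sqrtC (form u u) * sqrtC (form v v).
Proof.
rewrite -(@ler_pXn2r _ 2)// ?nnegrE ?mulr_ge0 ?sqrtC_ge0 ?dnorm_ge0//.
by rewrite exprMn !sqrtCK; exact: dot_CauchySchwarz.
Qed.

Lemma dot_triangle u v :
  sqrtC (form (u + v) (u + v)) <= sqrtC (form u u) + sqrtC (form v v).
Proof.
rewrite -(@ler_pXn2r _ 2)// ?nnegrE ?addr_ge0 ?sqrtC_ge0 ?dnorm_ge0//.
rewrite sqrrD !sqrtCK dnormD addrAC lerD2r lerD2l.
have -> : form u v + Num.conj (form u v) = 'Re (form u v) *+ 2.
  by rewrite ReE -mulr_natr divfK// pnatr_eq0.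
rewrite lerMn2r /=; apply: le_trans (dot_CauchySchwarz_sqrt u v).
by have [] := leif_Re_Creal (form u v).
Qed.

End CauchySchwarz.

Section L2Normed.
Variables (R : realType) (I : countType).
Local Notation C := R[i].
Local Notation l2 := (l2 R I).
Local Notation Re := (@complex.Re R).
Local Notation Im := (@complex.Im R).

Fact l2dot_herm (f h : l2) :
  l2dot f h = (-1) ^+ false * Num.conj (l2dot h f).
Proof. by rewrite expr0 mul1r l2dot_conj. Qed.

HB.instance Definition _ := isHermitianSesquilinear.Build C l2 false Num.conj
  (@l2dot R I) l2dot_herm.

Fact l2dot_pos (f : l2) : f != 0 -> 0 < l2dot f f.
Proof. by move=> f0; rewrite l2dotE ltcR l2sq_gt0. Qed.

HB.instance Definition _ := isDotProduct.Build C l2 (@l2dot R I) l2dot_pos.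

Definition l2form : {dot l2 for Num.conj} := @l2dot R I.

Definition l2norm (f : l2) : C := sqrtC (l2dot f f).

Lemma l2norm_sq f : l2norm f ^+ 2 = l2dot f f.
Proof. exact: sqrtCK. Qed.

Fact l2norm_triangle (f h : l2) : l2norm (f + h) <= l2norm f + l2norm h.
Proof. exact: (dot_triangle l2form). Qed.

Fact l2normZ c (f : l2) : l2norm (c *: f) = `|c| * l2norm f.
Proof.
rewrite /l2norm (dnormZ l2form) sqrtCM ?nnegrE ?exprn_ge0 ?(dnorm_ge0 l2form)//.
by rewrite sqrCK.
Qed.

Fact l2norm_eq0 (f : l2) : l2norm f = 0 -> f = 0.
Proof.
by move/eqP; rewrite (sqrt_dnorm_eq0 l2form) => /eqP.
Qed.

HB.instance Definition _ := Lmodule_isNormed.Build C l2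
  l2norm_triangle l2normZ l2norm_eq0.

Lemma l2_normE (f : l2) : `|f| ^+ 2 = (l2sq f)%:C.
Proof. by rewrite -l2dotE -l2norm_sq. Qed.

Lemma l2_norm_lt (f : l2) (e : R) : 0 < e ->
  (`|f| < e%:C) = (l2sq f < e ^+ 2).
Proof.
move=> e0; rewrite -ltcR -l2_normE rmorphXn /= ltr_pXn2r ?nnegrE ?normr_ge0//.
by rewrite lecR ltW.
Qed.

Lemma l2_norm_le (f : l2) (e : R) : 0 <= e ->
  (`|f| <= e%:C) = (l2sq f <= e ^+ 2).
Proof.
move=> e0; rewrite -lecR -l2_normE rmorphXn /= ler_pXn2r ?nnegrE ?normr_ge0//.
by rewrite lecR.
Qed.

Lemma nsq_ball_Re (z : C) (e : R) : 0 < e -> nsq z < e ^+ 2 -> `|Re z| < e.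
Proof.
move=> e0 ze; rewrite -(@ltr_pXn2r _ 2)// ?nnegrE ?ltW// real_normK ?num_real//.
by apply: le_lt_trans ze; rewrite lerDl sqr_ge0.
Qed.

Lemma nsq_ball_Im (z : C) (e : R) : 0 < e -> nsq z < e ^+ 2 -> `|Im z| < e.
Proof.
move=> e0 ze; rewrite -(@ltr_pXn2r _ 2)// ?nnegrE ?ltW// real_normK ?num_real//.
by apply: le_lt_trans ze; rewrite lerDr sqr_ge0.
Qed.

Lemma complex_gt0 (e : C) : 0 < e -> exists2 r : R, 0 < r & e = r%:C.
Proof.
case: e => a b; rewrite ltcE /= => /andP[/eqP -> a0].
by exists a.
Qed.

Lemma l2_ballE (f h : l2) (e : R) : 0 < e ->
  ball f (e%:C) h <-> l2sq (f - h) < e ^+ 2.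
Proof. by move=> e0; rewrite -ball_normE /ball_ /= l2_norm_lt. Qed.

(** A Cauchy filter converges at each coordinate.  The closed balls are stable
    under coordinatewise limits, because they are defined by bounds on finite
    sums; so the coordinatewise limit is also a limit in norm. *)
Fact l2_complete (F : set_system l2) : ProperFilter F -> cauchy F -> cvg F.
Proof.
move=> FP /cauchyP Fc.
have Fball (e : R) : 0 < e -> exists f : l2, F [set h | l2sq (f - h) < e ^+ 2].
  move=> e0; have eC0 : 0 < e%:C by rewrite ltcR.
  have [f Ff] := Fc _ eC0; exists f; apply: filterS Ff => h.
  by rewrite /= l2_ballE.
have coord_le (f h : l2) g : nsq (f g - h g) <= l2sq (f - h).
  have := @l2sq_ge _ _ (f - h) [:: g] isT.
  by rewrite big_seq1 l2DE l2NE.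
have cRe g : cvg ((fun f : l2 => Re (f g)) @ F).
  apply/cauchy_cvgP/cauchyP => e e0.
  have [f Ff] := Fball e e0; exists (Re (f g)).
  change (F [set h : l2 | ball (Re (f g)) e (Re (h g))]).
  apply: filterS Ff => h /= fh; rewrite -ball_normE /=.
  have -> : Re (f g) - Re (h g) = Re (f g - h g) by case: (f g) (h g) => ? ? [].
  by apply: nsq_ball_Re => //; exact: le_lt_trans fh.
have cIm g : cvg ((fun f : l2 => Im (f g)) @ F).
  apply/cauchy_cvgP/cauchyP => e e0.
  have [f Ff] := Fball e e0; exists (Im (f g)).
  change (F [set h : l2 | ball (Im (f g)) e (Im (h g))]).
  apply: filterS Ff => h /= fh; rewrite -ball_normE /=.
  have -> : Im (f g) - Im (h g) = Im (f g - h g) by case: (f g) (h g) => ? ? [].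
  by apply: nsq_ball_Im => //; exact: le_lt_trans fh.
pose lf (g : I) : C^o :=
  lim ((fun f : l2 => Re (f g)) @ F) +i* lim ((fun f : l2 => Im (f g)) @ F).
(* a bound on finite sums of coordinates passes to the coordinatewise limit *)
have lf_close (e : R) (f : l2) : 0 < e -> F [set h | l2sq (f - h) < e ^+ 2] ->
    sq_bounded (fun g => f g - lf g : C^o) (e ^+ 2).
  move=> e0 Ff n.
  have cg g : (fun h : l2 => nsq (f g - h g)) @ F --> nsq (f g - lf g).
    have -> : (fun h : l2 => nsq (f g - h g)) =
      (fun h : l2 => (Re (f g) - Re (h g)) ^+ 2 + (Im (f g) - Im (h g)) ^+ 2).
      by apply/funext => h; case: (f g) (h g) => ? ? [].
    have -> : nsq (f g - lf g) =
      (Re (f g) - lim ((fun f : l2 => Re (f g)) @ F)) ^+ 2 +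
      (Im (f g) - lim ((fun f : l2 => Im (f g)) @ F)) ^+ 2.
      by rewrite /lf; case: (f g) => ? ?.
    by apply: cvgD; apply: cvgM; (apply: cvgB; [exact: cvg_cst|]);
      [exact: cRe|exact: cRe|exact: cIm|exact: cIm].
  have cs : (fun h : l2 => \sum_(g <- initial I n) nsq (f g - h g)) @ F -->
      \sum_(g <- initial I n) nsq (f g - lf g).
    elim: (initial I n) => [|g s IHs].
      by under eq_fun do rewrite big_nil; rewrite big_nil; exact: cvg_cst.
    under eq_fun do rewrite big_cons; rewrite big_cons.
    by apply: cvgD => //; exact: cg.
  apply: (cvgr_to_le cs); apply: filterS Ff => h /= fh.
  apply: le_trans (ltW fh).
  exact: (l2sq_ge (f - h) (initial_uniq I n)).
have lfP : lf \in @sq_summable R I.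
  have [f Ff] := Fball 1 ltr01.
  have : (f : I -> C^o) - (fun g => f g - lf g) \in @sq_summable R I.
    rewrite rpredB ?l2_funP//; apply/asboolP; exists (1 ^+ 2).
    exact: lf_close Ff.
  rewrite (_ : _ - _ = lf)//; apply/funext => g.
  by rewrite !fctE opprB addrC subrK.
apply/cvg_ex; exists (L2 lfP).
apply/cvg_ballP => eps /complex_gt0[e e0 ->].
have e20 : 0 < e / 2 by rewrite divr_gt0.
have [f Ff] := Fball _ e20.
have fl : `|L2 lfP - f| <= (e / 2)%:C.
  rewrite distrC l2_norm_le ?(ltW e20)//.
  apply: (l2sq_le (M := (e / 2) ^+ 2)); exact: lf_close Ff.
near=> h; rewrite -ball_normE /=.
have fh : `|f - h| < (e / 2)%:C.
  by rewrite l2_norm_lt//; near: h.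
rewrite -(subrKA f); apply: le_lt_trans (ler_normD _ _) _.
rewrite [e in e%:C](splitr e) rmorphD /=; exact: ler_ltD.
Unshelve. all: by end_near.
Qed.

HB.instance Definition _ := Uniform_isComplete.Build l2 l2_complete.

End L2Normed.

(** * Separability of l2 *)

Section L2Separable.
Variables (R : realType) (I : countType).
Local Notation C := R[i].
Local Notation l2 := (l2 R I).

Lemma finite_support_summable (f : I -> C^o) n :
  (forall g, (n <= pickle g)%N -> f g = 0) -> f \in @sq_summable R I.
Proof.
move=> fn; apply/asboolP; exists (\sum_(g <- initial I n) nsq (f g)) => m.
rewrite (bigID (fun g => g \in initial I n)) /= [X in _ + X]big1 ?addr0.
  rewrite -big_filter; apply: ler_sum_sub.
  - by rewrite filter_uniq ?initial_uniq.
  - exact: initial_uniq.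
  - by move=> g; rewrite mem_filter => /andP[].
  - by move=> g; exact: nsq_ge0.
by move=> g; rewrite mem_initial -leqNgt => /fn ->; exact: nsq0.
Qed.

Definition trunc_fun n (f : l2) (g : I) : C^o :=
  if (pickle g < n)%N then f g else 0.

Lemma trunc_fun_summable n f : trunc_fun n f \in @sq_summable R I.
Proof.
apply: (@finite_support_summable _ n) => g ng.
by rewrite /trunc_fun ltnNge ng.
Qed.

Definition trunc n f : l2 := L2 (trunc_fun_summable n f).

(** The squared distance from f to its truncation is the part of the sum of
    |f g|^2 beyond a large initial segment. *)
Lemma trunc_close (f : l2) (e : R) : 0 < e ->
  exists n, l2sq (f - trunc n f) <= e.
Proof.
move=> e0.
have [n fn] : exists n, l2sq f - e < \sum_(g <- initial I n) nsq (f g).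
  apply: contrapT => h; have : l2sq f <= l2sq f - e.
    apply: l2sq_le => n; rewrite leNgt; apply/negP => fn; apply: h.
    by exists n.
  by rewrite leNgt ltrBlDr ltrDl e0.
exists n; apply: l2sq_le => m.
have -> : \sum_(g <- initial I m) nsq ((f - trunc n f) g) =
    \sum_(g <- [seq g <- initial I m | (n <= pickle g)%N]) nsq (f g).
  rewrite big_filter [RHS]big_mkcond; apply: eq_bigr => g _.
  have -> : (f - trunc n f) g = f g - trunc_fun n f g by [].
  rewrite /trunc_fun ltnNge; case: leqP => _ /=; first by rewrite subr0.
  by rewrite subrr nsq0.
rewrite -(lerD2r (\sum_(g <- initial I n) nsq (f g))) -big_cat /=.
apply: (@le_trans _ _ (l2sq f)); last by rewrite -lerBlDl ltW.
apply: l2sq_ge; rewrite cat_uniq filter_uniq ?initial_uniq//= andbT.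
apply/hasPn => g; rewrite mem_initial mem_filter => gn.
by rewrite leqNgt gn.
Qed.

(** The default value (0, 0) beyond the end of s makes the support finite. *)
Definition rat_fun (s : seq (rat * rat)) (g : I) : C^o :=
  let q := nth (0, 0) s (pickle g) in ratr q.1 +i* ratr q.2.

Lemma rat_fun_summable s : rat_fun s \in @sq_summable R I.
Proof.
apply: (@finite_support_summable _ (size s)) => g ng.
by rewrite /rat_fun nth_default //= rmorph0.
Qed.

Definition rat_l2 s : l2 := L2 (rat_fun_summable s).

Lemma rat_close (x e : R) : 0 < e -> exists q : rat, (x - ratr q) ^+ 2 < e.
Proof.
move=> e0; have s0 : 0 < Num.sqrt e by rewrite sqrtr_gt0.
have [q] := rat_in_itvoo (x:=x - Num.sqrt e) (y:=x + Num.sqrt e)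
  ltac:(by rewrite ltrBlDr -addrA ltrDl addr_gt0).
rewrite in_itv /= => /andP[q1 q2]; exists q.
rewrite -[ltRHS](@sqr_sqrtr _ e) ?ltW//.
rewrite -real_normK ?num_real// ltr_pXn2r ?nnegrE ?normr_ge0 ?sqrtr_ge0//.
by rewrite ltr_norml; apply/andP; split; lra.
Qed.

Lemma rat_l2_close (f : l2) (e : R) : 0 < e ->
  exists s, l2sq (f - rat_l2 s) <= e.
Proof.
move=> e0; have e40 : 0 < e / 4 by rewrite divr_gt0.
have [n fn] := trunc_close f e40.
have [N NE N0] : exists2 N : R, n.+1%:R = N & 0 < N by exists n.+1%:R.
pose d := e / 4 / (2 * N).
have d0 : 0 < d by rewrite divr_gt0// mulr_gt0.
have [q qP] := choice (fun x => rat_close x d0).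
pose s := [seq oapp (fun g => (q (complex.Re (f g)), q (complex.Im (f g))))
  (0, 0) (pickle_inv i) | i <- iota 0 n].
have sE g : (pickle g < n)%N ->
    rat_fun s g = ratr (q (complex.Re (f g))) +i* ratr (q (complex.Im (f g))).
  move=> gn; rewrite /rat_fun (nth_map 0%N) ?size_iota// nth_iota// add0n.
  by rewrite pickleK_inv.
have s0 g : (n <= pickle g)%N -> rat_fun s g = 0.
  by move=> ng; rewrite /rat_fun nth_default ?size_map ?size_iota//= rmorph0.
exists s; apply: l2sq_le => m.
apply: (@le_trans _ _ (\sum_(g <- initial I m)
  (2 * nsq ((f - trunc n f) g) + 2 * nsq (trunc_fun n f g - rat_fun s g)))).
  apply: ler_sum => g _.
  have -> : (f - rat_l2 s) g =
    (f - trunc n f) g + (trunc_fun n f g - rat_fun s g).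
    have -> : (f - trunc n f) g = f g - trunc_fun n f g by [].
    by rewrite subrKA.
  exact: nsqD.
rewrite big_split /= -!mulr_sumr.
have h1 : \sum_(g <- initial I m) nsq ((f - trunc n f) g) <= e / 4.
  by apply: le_trans fn; apply: l2sq_ge; exact: initial_uniq.
have h2 : \sum_(g <- initial I m) nsq (trunc_fun n f g - rat_fun s g) <= e / 4.
  rewrite (bigID (fun g => g \in initial I n)) /= [X in _ + X]big1 ?addr0; last first.
    move=> g; rewrite mem_initial -leqNgt => ng.
    by rewrite /trunc_fun ltnNge ng/= s0// subr0 nsq0.
  rewrite -big_filter.
  apply: (@le_trans _ _ (\sum_(g <- initial I n)
     nsq (trunc_fun n f g - rat_fun s g))).
    apply: ler_sum_sub; rewrite ?filter_uniq ?initial_uniq// => g.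
      by rewrite mem_filter => /andP[].
    exact: nsq_ge0.
  apply: (@le_trans _ _ (\sum_(g <- initial I n) (2 * d))).
    rewrite big_seq [leRHS]big_seq; apply: ler_sum => g.
    rewrite mem_initial => gn; rewrite /trunc_fun gn sE//.
    rewrite mulr2n mulrDl mul1r /nsq; case: (f g) => x y /=.
    by apply: ltW; apply: ltrD; exact: qP.
  rewrite big_const_seq count_predT iter_addr_0.
  have sn : (size (initial I n) <= n.+1)%N.
    rewrite size_pmap (leq_trans (count_size _ _))//.
    by rewrite size_iota leqnSn.
  apply: (@le_trans _ _ (2 * d *+ n.+1)).
    by rewrite -!(mulr_natr (2 * d)) ler_wpM2l ?ler_nat// mulr_ge0// ltW.
  have -> // : 2 * d *+ n.+1 = e / 4.
  by rewrite -mulr_natr NE /d; field; exact: lt0r_neq0.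
apply: (@le_trans _ _ (2 * (e / 4) + 2 * (e / 4))).
  by rewrite lerD// ler_wpM2l.
lra.
Qed.

Fact l2_separable : exists2 S : set l2, countable S & dense S.
Proof.
exists (range rat_l2).
  exact: (@sub_countable _ _ (range rat_l2) setT (card_image_le _ _)) (countableP _).
move=> O [f Of] oO.
have : nbhs f O by apply: open_nbhs_nbhs.
move/nbhs_ballP => [eps /complex_gt0[e e0 ->] fO].
have e20 : 0 < (e / 2) ^+ 2 by rewrite exprn_gt0 ?divr_gt0.
have [s fs] := rat_l2_close f e20.
exists (rat_l2 s); split; last by exists s.
apply: fO; apply/l2_ballE => //; apply: le_lt_trans fs _.
by rewrite ltr_pXn2r ?nnegrE ?divr_ge0 ?ltW//; lra.
Qed.

Definition l2_hilbert : hilbertSpace R :=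
  @HilbertSpace R l2 (@l2form R I) (fun f => l2norm_sq f) l2_separable.

End L2Separable.

(** * Translations on l2 of a countable group *)

Section Isometries.
Variables (R : realType) (H : hilbertSpace R).

Definition lin_isometry (f : H -> H) : Prop :=
  linear f /\ forall x, `|f x| = `|x|.

Lemma inner_CauchySchwarz (x y : H) : `|inner H x y| <= `|x| * `|y|.
Proof.
have nE (z : H) : `|z| = sqrtC (inner H z z).
  by rewrite -inner_normE sqrCK.
by rewrite !nE; exact: dot_CauchySchwarz_sqrt.
Qed.

Lemma hilbert_normE (x : H) : exists2 r : R, 0 <= r & `|x| = r%:C.
Proof.
have /complex_realP[r xr] := normr_real x; exists r => //.
by rewrite -ler0c -xr.
Qed.

End Isometries.

Section Translations.
Variables (R : realType) (I : countZmodType).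
Local Notation C := R[i].
Local Notation l2 := (l2 R I).

Definition shift_fun (g : I) (f : l2) (h : I) : C^o := f (h - g).

Lemma shift_fun_bounded g f : sq_bounded (shift_fun g f) (l2sq f).
Proof.
move=> n; have := @l2sq_ge _ _ f [seq h - g | h <- initial I n].
by rewrite big_map; apply; rewrite map_inj_uniq ?initial_uniq//; exact: addIr.
Qed.

Lemma shift_fun_summable g f : shift_fun g f \in @sq_summable R I.
Proof. by apply/asboolP; exists (l2sq f); exact: shift_fun_bounded. Qed.

Definition shift g f : l2 := L2 (shift_fun_summable g f).

Lemma shift0 f : shift 0 f = f.
Proof. by apply: l2_ext => h; rewrite /= /shift_fun subr0. Qed.

Lemma shiftD g h f : shift (g + h) f = shift g (shift h f).
Proof. by apply: l2_ext => k; rewrite /= /shift_fun /= /shift_fun opprD addrA. Qed.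

Lemma l2sq_shift g f : l2sq (shift g f) = l2sq f.
Proof.
have le g' f' : l2sq (shift g' f') <= l2sq f'.
  by apply: l2sq_le; exact: shift_fun_bounded.
apply/eqP; rewrite eq_le le /=.
by have := le (- g) (shift g f); rewrite -shiftD addNr shift0.
Qed.

Lemma l2_norm_eq (f h : l2) : l2sq f = l2sq h -> `|f| = `|h|.
Proof.
move=> e; apply/eqP; rewrite -(@eqrXn2 _ 2)// ?normr_ge0//.
by rewrite !l2_normE e.
Qed.

Lemma shift_isometry g : lin_isometry (shift g : l2_hilbert R I -> l2_hilbert R I).
Proof.
split; first by move=> c f h; apply: l2_ext => k.
by move=> f; apply: l2_norm_eq; exact: l2sq_shift.
Qed.

Lemma l2sq_trunc n (f : l2) : l2sq (trunc n f) <= l2sq f.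
Proof.
apply: l2sq_le => m; apply: le_trans (l2sq_ge f (initial_uniq I m)).
apply: ler_sum => g _; rewrite /= /trunc_fun; case: ifP => // _.
by rewrite nsq0 nsq_ge0.
Qed.

(** The support of a translate by g meets another finite support only when g is
    a difference of their points. *)
Lemma shift_trunc_orthogonal m n g (x y : l2) :
  g \notin [seq a - b | a <- initial I n, b <- initial I m] ->
  l2dot (shift g (trunc m x)) (trunc n y) = 0.
Proof.
move=> gE; rewrite /l2dot (_ : (fun _ => _) = fun=> 0).
  have rtot0 : rtot (fun _ : I => 0 : R) = 0.
    rewrite /rtot (_ : (fun n => _) = cst 0) ?lim_cst//.
    by apply/funext => k; rewrite big1.
  by rewrite /ctot /= rtot0.
apply/funext => h; rewrite /= /shift_fun /= /trunc_fun.
case: ifP => hg; last by rewrite mul0r.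
case: ifP => hn; last first.
  by transitivity (x (h - g) * 0); [congr (_ * _); exact: conjc0|exact: mulr0].
case/negP: gE; apply/allpairsP; exists (h, h - g); rewrite /= !mem_initial hg hn.
by rewrite subKr.
Qed.

(** Matrix coefficients of finitely supported vectors vanish for all but finitely
    many g; general vectors are approximated by truncation. *)
Lemma shift_c0 (x y : l2_hilbert R I) (e : R) : 0 < e ->
  exists E : seq I, forall g, g \notin E ->
    `|inner (l2_hilbert R I) (shift g x) y| <= e%:C.
Proof.
move=> e0.
have [X X0 xX] := hilbert_normE x; have [Y Y0 yY] := hilbert_normE y.
pose d := e / (X + Y + 1).
have s0 : 0 < X + Y + 1 by rewrite ltr_wpDl// addr_ge0.
have d0 : 0 < d by rewrite divr_gt0.
have d20 : 0 < d ^+ 2 by rewrite exprn_gt0.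
have [m xm] := trunc_close x d20; have [n yn] := trunc_close y d20.
exists [seq a - b | a <- initial I n, b <- initial I m] => g gE.
pose x1 : l2_hilbert R I := trunc m x; pose y1 : l2_hilbert R I := trunc n y.
have [shift_lin shift_norm] := shift_isometry g.
have xd : `|shift g (x - x1) : l2_hilbert R I| <= d%:C.
  by rewrite shift_norm l2_norm_le ?(ltW d0).
have yd : `|y - y1| <= d%:C by rewrite l2_norm_le ?(ltW d0).
have x1X : `|shift g x1 : l2_hilbert R I| <= X%:C.
  rewrite shift_norm l2_norm_le//; apply: le_trans (l2sq_trunc _ _) _.
  by rewrite -l2_norm_le// -xX.
have -> : inner (l2_hilbert R I) (shift g x) y =
    inner (l2_hilbert R I) (shift g (x - x1)) y +
    inner (l2_hilbert R I) (shift g x1) (y - y1).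
  have -> : inner (l2_hilbert R I) (shift g x1) (y - y1) =
    inner (l2_hilbert R I) (shift g x1) y.
    rewrite linearBr/= [X in _ - X](_ : _ = 0) ?subr0//.
    exact: shift_trunc_orthogonal.
  rewrite -linearDl /=; congr (inner _ _ y).
  rewrite -[shift g x1]scale1r addrC -shift_lin scale1r.
  by rewrite addrC subrK.
apply: le_trans (ler_normD _ _) _.
apply: (@le_trans _ _ ((d * Y)%:C + (X * d)%:C)).
  apply: lerD.
    apply: le_trans (inner_CauchySchwarz _ _) _.
    by rewrite yY rmorphM ler_wpM2r// ler0c.
  apply: le_trans (inner_CauchySchwarz _ _) _.
  by rewrite rmorphM ler_pM.
rewrite -rmorphD lecR /=.
have -> : d * Y + X * d = d * (X + Y) by ring.
by rewrite -[leRHS](@divfK _ (X + Y + 1)) ?gt_eqF// ler_wpM2l ?lerDl// ltW.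
Qed.

Lemma l2_nontrivial : exists x : l2_hilbert R I, x != 0.
Proof.
have dP : (fun g : I => (g == 0)%:R : C^o) \in @sq_summable R I.
  apply: (@finite_support_summable _ _ _ (pickle (0 : I)).+1) => g.
  by case: eqP => [->|//]; rewrite ltnn.
exists (L2 dP); apply/eqP => /(congr1 (fun f : l2 => f 0)) /=.
by move/eqP; rewrite eqxx oner_eq0.
Qed.

End Translations.

(** The regular representation, with the property that its coefficients vanish
    at infinity.  A nonzero vector is provided since the zero space would
    identify the limits 0 and Id. *)
Theorem c0_representation (R : realType) (I : countZmodType) :
  exists (H : hilbertSpace R) (T : I -> H -> H),
  [/\ forall g, lin_isometry (T g),
      T 0 =1 id,
      forall g h x, T (g + h) x = T g (T h x),
      exists x : H, x != 0 &
      forall x y (e : R), 0 < e -> exists E : seq I, forall g, g \notin E ->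
        `|inner H (T g x) y| <= e%:C].
Proof.
exists (l2_hilbert R I), (@shift R I); split.
- exact: shift_isometry.
- exact: shift0.
- exact: shiftD.
- exact: l2_nontrivial.
- exact: shift_c0.
Qed.

(** * The characters of the real line *)

Section UnitCircle.
Variable R : realType.
Local Notation C := R[i].

Definition cis (x : R) : C := cos (pi *+ 2 * x) +i* sin (pi *+ 2 * x).

Lemma cisD x y : cis (x + y) = cis x * cis y.
Proof.
rewrite /cis mulrDr cosD sinD mulcE.
by congr (_ +i* _); exact: addrC.
Qed.

Lemma cis0 : cis 0 = 1.
Proof. by rewrite /cis mulr0 cos0 sin0. Qed.

Lemma cis1 : cis 1 = 1.
Proof. by rewrite /cis mulr1 cos2pi sin2pi. Qed.

Lemma cisMn x n : cis (x * n%:R) = cis x ^+ n.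
Proof.
elim: n => [|n IHn]; first by rewrite mulr0 cis0.
by rewrite -natr1 mulrDr mulr1 cisD IHn exprSr.
Qed.

Lemma cisN_mul x : cis (- x) * cis x = 1.
Proof. by rewrite -cisD addNr cis0. Qed.

Lemma cis_int (z : int) : cis z%:~R = 1.
Proof.
have cisn n : cis n%:R = 1 by rewrite -[n%:R]mul1r cisMn cis1 expr1n.
case: z => n; first exact: cisn.
by rewrite NegzE mulrNz -[LHS]mulr1 -[X in _ * X](cisn n.+1) cisN_mul.
Qed.

Lemma cis_conj x : Num.conj (cis x) = cis (- x).
Proof.
have -> : Num.conj (cis x) = (cis x)^* by [].
by rewrite /cis /= mulrN cosN sinN.
Qed.

Lemma norm_cis x : `|cis x| = 1.
Proof. by rewrite normc_def /= cos2Dsin2 sqrtr1. Qed.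

(** The cosine is injective on [0, pi], and the angle or its complement to a full
    turn lies there. *)
Lemma cis_neq1 x : 0 < x < 1 -> cis x != 1.
Proof.
move=> /andP[x0 x1]; apply/eqP => -[cx _].
have pi20 : 0 < (pi : R) *+ 2 by rewrite mulrn_wgt0// pi_gt0.
have t0 : 0 < pi *+ 2 * x by rewrite mulr_gt0.
have t1 : pi *+ 2 * x < pi *+ 2 by rewrite gtr_pMr.
have [tpi|tpi] := leP (pi *+ 2 * x) pi.
  have t_eq0 : pi *+ 2 * x = 0.
    by apply: (@cos_inj R); rewrite ?cos0// in_itv /= ?lexx ?pi_ge0// (ltW t0).
  by rewrite t_eq0 ltxx in t0.
have t_eq0 : pi *+ 2 - pi *+ 2 * x = 0.
  apply: (@cos_inj R); rewrite ?in_itv /= ?lexx ?pi_ge0//.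
    by rewrite subr_ge0 (ltW t1) /= lerBlDr mulr2n lerD2l ltW.
  by rewrite cosB cos2pi sin2pi mul1r mul0r addr0 cos0.
by rewrite -subr_gt0 t_eq0 ltxx in t1.
Qed.

Lemma ler_norm_sin (t : R) : `|sin t| <= `|t|.
Proof.
wlog t0 : t / 0 <= t.
  move=> h; have [/h//|t0] := leP 0 t.
  by rewrite -normrN -sinN -[leRHS]normrN h// oppr_ge0 ltW.
have [->|tn0] := eqVneq t 0; first by rewrite sin0 normr0.
have {tn0}t_gt0 : 0 < t by rewrite lt_neqAle eq_sym tn0.
have [|c] := @MVT R sin cos 0 t t_gt0 (fun y _ => is_derive_sin y).
  by apply: continuous_subspaceT; exact: continuous_sin.
move=> _; rewrite sin0 !subr0 => ->; rewrite normrM.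
by rewrite ler_piMl// cos_max.
Qed.

Lemma ler_norm_cos1 (t : R) : `|cos t - 1| <= `|t|.
Proof.
have tE : t = (t / 2) *+ 2 by rewrite -mulr_natr divfK.
rewrite [in cos t]tE cos_mulr2n cos2sin2.
have -> : (1 - sin (t / 2) ^+ 2) *+ 2 - 1 - 1 = - (sin (t / 2) ^+ 2 *+ 2).
  by ring.
rewrite normrN normrMn normrX expr2 [in leRHS]tE normrMn ler_wMn2r//.
apply: le_trans (ler_norm_sin _).
by rewrite ler_piMl// sin_max.
Qed.

Lemma cis_lipschitz x : `|cis x - 1| <= (4 * pi * `|x|)%:C.
Proof.
have -> : cis x - 1 = (cos (pi *+ 2 * x) - 1)%:C + 'i%C * (sin (pi *+ 2 * x))%:C.
  rewrite /cis /real_complex_def mulcE; apply/eqP; rewrite eq_complex /=.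
  by rewrite !(mulr0, mul0r, mul1r, subr0, addr0, add0r) !eqxx.
apply: le_trans (ler_normD _ _) _.
have -> : 4 * pi * `|x| = `|pi *+ 2 * x| + `|pi *+ 2 * x|.
  rewrite normrM normrMn (ger0_norm (pi_ge0 _)) -mulr_natr; ring.
rewrite [in leRHS]rmorphD lerD//.
  by rewrite normc_def /= expr0n /= addr0 sqrtr_sqr lecR ler_norm_cos1.
rewrite normrM [X in X * _](_ : _ = 1) ?mul1r; last first.
  by rewrite normc_def /= expr0n expr1n add0r sqrtr1.
by rewrite normc_def /= expr0n /= addr0 sqrtr_sqr lecR ler_norm_sin.
Qed.

(** Orthogonality of the characters of Z/d: for r and s distinct modulo d this is a
    geometric sum with ratio a d-th root of unity other than 1. *)
Lemma sum_cis d (r s : nat) : (r < d)%N -> (s < d)%N ->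
  \sum_(k < d) cis ((r%:R - s%:R) / d%:R * k%:R) = if r == s then d%:R else 0.
Proof.
move=> rd sd; have d0 : (0 < d)%N by exact: leq_ltn_trans rd.
have dR0 : 0 < d%:R :> R by rewrite ltr0n.
under eq_bigr do rewrite cisMn.
case: eqP => [->|/eqP rs].
  rewrite subrr mul0r cis0; under eq_bigr do rewrite expr1n.
  by rewrite sumr_const card_ord.
have z1 : cis ((r%:R - s%:R) / d%:R) != 1.
  wlog sr : r s rd sd rs / (s < r)%N.
    move=> h; case: (ltngtP r s) rs => // [rs|sr] _; last first.
      by apply: h => //; rewrite gtn_eqF.
    have := h s r sd rd; rewrite gtn_eqF// => /(_ isT rs).
    apply: contra => /eqP z1; rewrite -opprB mulNr.
    have := cisN_mul ((r%:R - s%:R) / d%:R).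
    by rewrite z1 mulr1 => ->.
  apply: cis_neq1; rewrite divr_gt0 ?subr_gt0 ?ltr_nat//=.
  rewrite ltr_pdivrMr// mul1r ltrBlDr ltr_wpDr//.
  by rewrite ltr_nat.
set z := cis _ in z1 *.
have : (z - 1) * \sum_(k < d) z ^+ k = 0.
  rewrite -subrX1 /z -cisMn divfK ?gt_eqF//.
  have -> : r%:R - s%:R = (r%:Z - s%:Z)%:~R :> R by rewrite intrB.
  by rewrite cis_int subrr.
by move/eqP; rewrite mulf_eq0 subr_eq0 (negbTE z1) /= => /eqP.
Qed.

End UnitCircle.

(** * Linear isometries of a Hilbert space *)

Section LinearMaps.
Variables (K : nzRingType) (V W : lmodType K) (f : V -> W).
Hypothesis lf : linear f.

Lemma lin_D x y : f (x + y) = f x + f y.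
Proof. by rewrite -[x]scale1r lf !scale1r. Qed.

Lemma lin_0 : f 0 = 0.
Proof. by apply: (@addrI _ (f 0)); rewrite -lin_D !addr0. Qed.

Lemma lin_Z c x : f (c *: x) = c *: f x.
Proof. by rewrite -[c *: x]addr0 lf lin_0 addr0. Qed.

Lemma lin_B x y : f (x - y) = f x - f y.
Proof. by rewrite -scaleN1r lin_D lin_Z scaleN1r. Qed.

Lemma lin_sum n (F : 'I_n -> V) : f (\sum_(k < n) F k) = \sum_(k < n) f (F k).
Proof.
elim: n F => [|n IHn] F; first by rewrite !big_ord0 lin_0.
by rewrite !big_ord_recr /= lin_D IHn.
Qed.

End LinearMaps.

Section HilbertIsometries.
Variables (R : realType) (H : hilbertSpace R).
Local Notation C := R[i].
Local Notation dot := (inner H).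

Lemma dot_real_part (x y : H) :
  dot x y + Num.conj (dot x y) = `|x + y| ^+ 2 - `|x| ^+ 2 - `|y| ^+ 2.
Proof.
by rewrite !inner_normE dnormD; ring.
Qed.

(** Polarization: the norms of x + y and x + i y determine the real and imaginary
    parts of the inner product. *)
Lemma isometry_dot (f : H -> H) x y :
  lin_isometry f -> dot (f x) (f y) = dot x y.
Proof.
move=> [lf nf].
have re x' y' : dot (f x') (f y') + Num.conj (dot (f x') (f y')) =
    dot x' y' + Num.conj (dot x' y').
  by rewrite !dot_real_part -lin_D// !nf.
have r1 := re x y; have := re x ('i *: y).
rewrite lin_Z// !linearZr_LR /= !rmorphM /= !conjCK conjCi => r2.
have i0 : 'i != 0 :> C by exact: neq0Ci.
apply: (@mulfI _ (2 : C)); first by rewrite pnatr_eq0.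
(* both parts of the inner product are now known to be preserved *)
have e : dot (f x) (f y) - Num.conj (dot (f x) (f y)) =
    dot x y - Num.conj (dot x y).
  apply: (mulfI i0); apply: oppr_inj.
  rewrite !mulrBr !opprB.
  move: r2; rewrite !mulNr addrC => ->; exact: addrC.
rewrite !mulr2n !mulrDl !mul1r.
rewrite -[X in X + _ = _](subrK (Num.conj (dot (f x) (f y)))) e.
by rewrite -addrA [Num.conj _ + _]addrC r1; ring.
Qed.

Lemma isometry_id : lin_isometry (id : H -> H).
Proof. by split. Qed.

Lemma isometry_comp (f g : H -> H) :
  lin_isometry f -> lin_isometry g -> lin_isometry (f \o g).
Proof.
move=> [lf nf] [lg ng]; split=> [c x y|x] /=; first by rewrite lg lf.
by rewrite nf ng.
Qed.

Lemma isometry_dist (f : H -> H) x y : lin_isometry f -> `|f x - f y| = `|x - y|.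
Proof. by move=> [lf nf]; rewrite -lin_B. Qed.

Lemma normsq_sum_orthogonal n (v : 'I_n -> H) :
  (forall i j, i != j -> dot (v i) (v j) = 0) ->
  `|\sum_(i < n) v i| ^+ 2 = \sum_(i < n) `|v i| ^+ 2.
Proof.
move=> ov; rewrite inner_normE linear_sumr /=; apply: eq_bigr => i _.
rewrite inner_normE linear_sumlz /= (bigD1 i)//= big1 ?addr0// => j ji.
exact: ov.
Qed.

End HilbertIsometries.

(** * One-parameter groups of isometries *)

Section Flows.
Variables (R : realType) (H : hilbertSpace R).
Local Notation C := R[i].
Local Notation dot := (inner H).

Record flow (W : R -> H -> H) : Prop := Flow {
  flow_isometry : forall t, lin_isometry (W t);
  flow0 : W 0 =1 id;
  flowD : forall s t x, W (s + t) x = W s (W t x)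
}.

End Flows.

Section RootFlow.
Variables (R : realType) (H : hilbertSpace R) (d : nat) (T : H -> H).
Hypothesis d_gt0 : (0 < d)%N.
Hypothesis T_iso : lin_isometry T.
Hypothesis T_order : iter d T =1 id.
Local Notation C := R[i].
Local Notation dot := (inner H).

Let dR0 : (d%:R : R) != 0. Proof. by rewrite pnatr_eq0 -lt0n. Qed.
Let dC0 : (d%:R : C) != 0. Proof. by rewrite pnatr_eq0 -lt0n. Qed.

(** The orthogonal projection onto the eigenspace of T for the eigenvalue
    exp(2 i pi r / d): the average over the powers of T against a character of Z/d. *)
Definition eigenproj (r : 'I_d) (x : H) : H :=
  d%:R^-1 *: \sum_(k < d) cis (- (r%:R / d%:R * k%:R) : R) *: iter k T x.

(** The operator T^h, through the spectral decomposition of T with the arguments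
    of the eigenvalues, counted in full turns, chosen in [0, 1). *)
Definition root_flow (h : R) (x : H) : H :=
  \sum_(r < d) cis (r%:R / d%:R * h) *: eigenproj r x.

Let T_lin : linear T. Proof. by have [] := T_iso. Qed.

Let iter_lin k : linear (iter k T).
Proof. by elim: k => [|k IHk] c x y //=; rewrite IHk T_lin. Qed.

Lemma eigenproj_linear r : linear (eigenproj r).
Proof.
move=> c x y; rewrite /eigenproj scalerA [c * _]mulrC -scalerA -scalerDr.
congr (_ *: _); rewrite scaler_sumr -big_split /=; apply: eq_bigr => k _.
by rewrite iter_lin scalerDr !scalerA [c * _]mulrC.
Qed.

Lemma root_flow_linear h : linear (root_flow h).
Proof.
move=> c x y; rewrite /root_flow scaler_sumr -big_split /=.
apply: eq_bigr => r _; rewrite eigenproj_linear scalerDr !scalerA.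
by rewrite [c * _]mulrC.
Qed.

Lemma eigenproj_sum x : \sum_(r < d) eigenproj r x = x.
Proof.
rewrite /eigenproj -scaler_sumr exchange_big /=.
rewrite (bigD1 (Ordinal d_gt0))//= [X in _ + X]big1 ?addr0; last first.
  move=> k k0; rewrite -scaler_suml.
  have := @sum_cis R d 0 k d_gt0 (ltn_ord k).
  rewrite eq_sym [(_ == _)](negbTE k0) => sk.
  rewrite (eq_bigr (fun i : 'I_d => cis ((0%:R - k%:R) / d%:R * i%:R : R))).
    by rewrite sk scale0r.
  by move=> i _; congr cis; field.
under eq_bigr do rewrite mulr0 oppr0 cis0 scale1r.
by rewrite sumr_const card_ord /= -[x *+ d]scaler_nat scalerA mulVf// scale1r.
Qed.

(** Applying T shifts the sum over Z/d by one step, which closes up cyclically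
    because T^d is the identity. *)
Lemma eigenproj_eigen r x :
  T (eigenproj r x) = cis (r%:R / d%:R : R) *: eigenproj r x.
Proof.
rewrite /eigenproj (lin_Z T_lin) (lin_sum T_lin) scalerA [cis _ * _]mulrC -scalerA.
congr (_ *: _); rewrite scaler_sumr.
pose u k : H := cis (r%:R / d%:R - r%:R / d%:R * k%:R : R) *: iter k T x.
transitivity (\sum_(k < d) u k.+1).
  apply: eq_bigr => k _; rewrite (lin_Z T_lin) /u /=; congr (cis _ *: _).
  by rewrite -natr1; ring.
transitivity (\sum_(k < d) u k); last first.
  by apply: eq_bigr => k _; rewrite scalerA -cisD.
have ud : u d = u 0%N.
  rewrite /u T_order mulr0 subr0 divfK// cisD.
  have -> : - r%:R = (- r%:Z)%:~R :> R by rewrite rmorphN.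
  by rewrite cis_int mulr1.
case: (d) ud => [|n] ud; first by rewrite !big_ord0.
by rewrite big_ord_recr [RHS]big_ord_recl /= ud addrC.
Qed.

(** Eigenvectors of an isometry for distinct eigenvalues of modulus 1. *)
Lemma eigenproj_orthogonal r s x y : r != s ->
  dot (eigenproj r x) (eigenproj s y) = 0.
Proof.
move=> rs; apply/eqP; have := isometry_dot (eigenproj r x) (eigenproj s y) T_iso.
rewrite !eigenproj_eigen linearZl_LR linearZr_LR /= mulrA cis_conj -cisD.
move/eqP; rewrite -subr_eq0 -[X in _ - X]mul1r -mulrBl mulf_eq0 => /orP[|//].
rewrite subr_eq0 => /eqP e; exfalso.
have := @sum_cis R d r s (ltn_ord r) (ltn_ord s).
rewrite [nat_of_ord _ == _](negbTE rs).
under eq_bigr do rewrite mulrBl cisMn e expr1n.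
by rewrite sumr_const card_ord => /eqP; rewrite (negbTE dC0).
Qed.

Lemma eigenproj_mul r s x :
  eigenproj r (eigenproj s x) = if r == s then eigenproj s x else 0.
Proof.
have iterE k : iter k T (eigenproj s x) =
    cis (s%:R / d%:R * k%:R : R) *: eigenproj s x.
  elim: k => [|k IHk] /=; first by rewrite mulr0 cis0 scale1r.
  rewrite IHk (lin_Z T_lin) eigenproj_eigen scalerA -cisD -natr1.
  by congr (cis _ *: _); ring.
rewrite {1}/eigenproj.
under eq_bigr do rewrite iterE scalerA -cisD.
rewrite -scaler_suml.
rewrite (eq_bigr (fun k : 'I_d => cis ((s%:R - r%:R) / d%:R * k%:R : R))); last first.
  by move=> k _; congr cis; ring.
rewrite sum_cis// [nat_of_ord _ == _]eq_sym.
have [->|rs] := eqVneq r s; first by rewrite eqxx scalerA mulVf// scale1r.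
by rewrite [nat_of_ord _ == _](negbTE rs) scale0r scaler0.
Qed.

Lemma eigenproj_root_flow r h x :
  eigenproj r (root_flow h x) = cis (r%:R / d%:R * h) *: eigenproj r x.
Proof.
rewrite /root_flow (lin_sum (eigenproj_linear r)) (bigD1 r)//= big1 ?addr0.
  by rewrite (lin_Z (eigenproj_linear r)) eigenproj_mul eqxx.
move=> s sr; rewrite (lin_Z (eigenproj_linear r)) eigenproj_mul eq_sym.
by rewrite (negbTE sr) scaler0.
Qed.

Lemma normsq_eigenproj (c : 'I_d -> C) x : (forall r, `|c r| = 1) ->
  `|\sum_(r < d) c r *: eigenproj r x| ^+ 2 =
  \sum_(r < d) `|eigenproj r x| ^+ 2.
Proof.
move=> c1; rewrite normsq_sum_orthogonal.
  by apply: eq_bigr => r _; rewrite normrZ c1 mul1r.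
move=> r s rs; rewrite linearZl_LR linearZr_LR /= eigenproj_orthogonal//.
by rewrite !mulr0.
Qed.

Lemma normsq_eigenproj_sum x : `|x| ^+ 2 = \sum_(r < d) `|eigenproj r x| ^+ 2.
Proof.
rewrite -(@normsq_eigenproj (fun=> 1)) => [|r]; last exact: normr1.
by under eq_bigr do rewrite scale1r; rewrite eigenproj_sum.
Qed.

Lemma norm_eigenproj r x : `|eigenproj r x| <= `|x|.
Proof.
rewrite -(@ler_pXn2r _ 2)// ?nnegrE// [leRHS]normsq_eigenproj_sum.
by rewrite (bigD1 r)//= lerDl sumr_ge0// => s _; rewrite exprn_ge0.
Qed.

Lemma root_flowP : flow root_flow.
Proof.
split.
- move=> h; split; first exact: root_flow_linear.
  move=> x; apply/eqP; rewrite -(@eqrXn2 _ 2)//.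
  rewrite /root_flow normsq_eigenproj ?normsq_eigenproj_sum// => r.
  exact: norm_cis.
- move=> x; rewrite /root_flow /=.
  by under eq_bigr do rewrite mulr0 cis0 scale1r; exact: eigenproj_sum.
- move=> h h' x; rewrite {1 2}/root_flow; apply: eq_bigr => r _.
  by rewrite eigenproj_root_flow scalerA -cisD mulrDr.
Qed.

Lemma root_flow1 x : root_flow 1 x = T x.
Proof.
rewrite -{2}[x]eigenproj_sum (lin_sum T_lin) /root_flow.
by apply: eq_bigr => r _; rewrite eigenproj_eigen mulr1.
Qed.

Lemma root_flow_period (z : int) x : root_flow (d%:R * z%:~R) x = x.
Proof.
rewrite -[RHS]eigenproj_sum /root_flow; apply: eq_bigr => r _.
rewrite mulrA divfK//.
have -> : r%:R * z%:~R = (r%:Z * z)%:~R :> R by rewrite intrM.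
by rewrite cis_int scale1r.
Qed.

(** Each of the d spectral components moves by at most 4 pi |h| |x|.  This crude
    constant depends on d only, which is what the infinite product needs. *)
Lemma root_flow_lipschitz h x :
  `|root_flow h x - x| <= (d%:R * (4 * pi) * `|h|)%:C * `|x|.
Proof.
rewrite -{2}[x]eigenproj_sum /root_flow -sumrB.
apply: le_trans (ler_norm_sum _ _ _) _.
apply: (@le_trans _ _ (\sum_(r < d) (4 * pi * `|h|)%:C * `|x|)).
  apply: ler_sum => r _; rewrite -[X in _ - X]scale1r -scalerBl normrZ.
  rewrite ler_pM// ?norm_eigenproj//; apply: le_trans (cis_lipschitz _) _.
  rewrite lecR ler_wpM2l ?mulr_ge0 ?pi_ge0// normrM ler_piMl//.
  rewrite ger0_norm ?divr_ge0// ler_pdivrMr ?ltr0n// mul1r ler_nat.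
  exact: ltnW.
rewrite sumr_const card_ord -[_ *+ d]mulr_natl mulrA.
rewrite (_ : d%:R * _ = (d%:R * (4 * pi) * `|h|)%:C)//.
have -> : d%:R = (d%:R : R)%:C by rewrite (rmorph_nat (real_complex R)).
by rewrite -(rmorphM (real_complex R)) /= !mulrA.
Qed.

Lemma root_flow_commute (f : H -> H) h x : linear f ->
  (forall y, f (T y) = T (f y)) -> f (root_flow h x) = root_flow h (f x).
Proof.
move=> lf fT; rewrite /root_flow (lin_sum lf); apply: eq_bigr => r _.
rewrite (lin_Z lf) /eigenproj (lin_Z lf) (lin_sum lf).
congr (_ *: (_ *: _)); apply: eq_bigr => k _; rewrite (lin_Z lf); congr (_ *: _).
by elim: (nat_of_ord k) => //= j IHj; rewrite fT IHj.
Qed.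

End RootFlow.

(** * Products of commuting flows *)

Section ProductFlow.
Variables (R : realType) (H : hilbertSpace R).
Local Notation C := R[i].

Fixpoint comp_upto (f : nat -> H -> H) n (x : H) : H :=
  if n is m.+1 then f m (comp_upto f m x) else x.

Definition prod_flow (W : nat -> R -> H -> H) n (t : R) : H -> H :=
  comp_upto (fun k => W k t) n.

Lemma comp_upto_isometry f n :
  (forall k, (k < n)%N -> lin_isometry (f k)) -> lin_isometry (comp_upto f n).
Proof.
elim: n => [|n IHn] fi /=; first exact: isometry_id.
apply: (@isometry_comp _ _ (f n) (comp_upto f n)); first exact: fi.
by apply: IHn => k /ltnW/fi.
Qed.

Lemma comp_upto_commute f n (g : H -> H) x :
  (forall k y, (k < n)%N -> g (f k y) = f k (g y)) ->
  g (comp_upto f n x) = comp_upto f n (g x).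
Proof.
elim: n => //= n IHn fg; rewrite fg// IHn// => k y /ltnW kn; exact: fg.
Qed.

(** Replacing the factors one at a time costs the sum of the errors, since the
    remaining factors are isometries. *)
Lemma comp_upto_close (f h : nat -> H -> H) (delta : nat -> R) n x :
  (forall k, (k < n)%N -> lin_isometry (f k)) ->
  (forall k, (k < n)%N -> lin_isometry (h k)) ->
  (forall k y, (k < n)%N -> `|f k y - h k y| <= (delta k)%:C * `|y|) ->
  `|comp_upto f n x - comp_upto h n x| <= (\sum_(k < n) delta k)%:C * `|x|.
Proof.
elim: n => [|n IHn] fi hi fh /=.
  by rewrite subrr normr0 mulr_ge0// big_ord0 lexx.
rewrite -(subrKA (f n (comp_upto h n x))).
apply: le_trans (ler_normD _ _) _.
rewrite big_ord_recr rmorphD mulrDl lerD//.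
  rewrite isometry_dist; last exact: fi.
  by apply: IHn => k *; [apply: fi|apply: hi|apply: fh]; exact: ltnW.
apply: le_trans (fh _ _ _) _ => //.
suff [_ ->] : lin_isometry (comp_upto h n) by [].
by apply: comp_upto_isometry => k /ltnW/hi.
Qed.

Lemma prod_flowP (W : nat -> R -> H -> H) n :
  (forall k, (k < n)%N -> flow (W k)) ->
  (forall i j s t x, W i s (W j t x) = W j t (W i s x)) ->
  flow (prod_flow W n).
Proof.
move=> fW WW; split.
- by move=> t; apply: comp_upto_isometry => k /fW[].
- elim: n fW => // n IHn fW x; rewrite /prod_flow /= [W n 0 _]flow0; last exact: fW.
  by apply: IHn => k /ltnW/fW.
- elim: n fW => // n IHn fW s t x; rewrite /prod_flow /= flowD; last exact: fW.
  congr (W n s _); rewrite [comp_upto _ n x]IHn => [|k /ltnW/fW//].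
  by apply: comp_upto_commute => k y kn; exact: WW.
Qed.

End ProductFlow.

Section InfiniteProduct.
Variables (R : realType) (H : hilbertSpace R).
Local Notation C := R[i].

Lemma pow2_small (b e : R) : 0 < e -> exists n, b / 2 ^+ n < e.
Proof.
move=> e0; pose n := Num.bound `|b / e|; exists n.
rewrite ltr_pdivrMr ?exprn_gt0// mulrC -ltr_pdivrMr//.
apply: le_lt_trans (ler_norm _) _.
apply: lt_le_trans (archi_boundP (normr_ge0 _)) _.
by rewrite -natrX ler_nat ltnW// ltn_expl.
Qed.

Lemma ler_pow2 (a b r : R) : (forall n, r <= a + b / 2 ^+ n) -> r <= a.
Proof.
move=> h; apply/ler_addgt0Pr => e e0; have [n bn] := pow2_small b e0.
by apply: le_trans (h n) _; rewrite lerD2l ltW.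
Qed.

Lemma eq_pow2 (x y : H) (b : R) :
  (forall n, `|x - y| <= (b / 2 ^+ n)%:C) -> x = y.
Proof.
move=> h; apply/eqP; rewrite -subr_eq0 -normr_eq0.
have [r r0 xyr] := hilbert_normE (x - y); rewrite xyr.
have -> : r = 0; last by [].
apply/eqP; rewrite eq_le r0 andbT; apply: (@ler_pow2 _ b) => n.
by rewrite add0r -lecR -xyr.
Qed.

Lemma geometric_limit (v : nat -> H) (b : R) :
  (forall n k, `|v (n + k)%N - v n| <= (b / 2 ^+ n)%:C) ->
  exists l, forall n, `|l - v n| <= (b / 2 ^+ n)%:C.
Proof.
move=> vb.
have : cvg (v @ \oo).
  apply/cauchy_cvgP/cauchyP => eps /complex_gt0[e e0 ->].
  have [n bn] := pow2_small b e0; exists (v n).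
  exists n => // m /= nm; rewrite -ball_normE /= distrC.
  rewrite -(subnKC nm); apply: le_lt_trans (vb _ _) _.
  by rewrite ltcR.
case/cvg_ex => l /cvg_ballP vl; exists l => n.
have [r r0 lr] := hilbert_normE (l - v n); rewrite lr lecR.
apply/ler_addgt0Pr => e e0.
have e0C : 0 < e%:C by rewrite ltcR.
have [m _ vm] := vl _ e0C.
have := vm (n + m)%N (leq_addl _ _); rewrite -ball_normE /= => lvm.
rewrite -lecR -lr rmorphD /= -(subrKA (v (n + m)%N)) addrC.
by rewrite (le_trans (ler_normD _ _))// lerD// ltW.
Qed.

Lemma norm_pow2 (x : H) (r b : R) :
  (forall n, exists2 y : H, `|y| = r%:C & `|x - y| <= (b / 2 ^+ n)%:C) ->
  `|x| = r%:C.
Proof.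
move=> h; have [s s0 xs] := hilbert_normE x; rewrite xs; congr (_%:C).
apply/eqP; rewrite eq_le; apply/andP; split; apply: (@ler_pow2 _ b) => n;
  have [y yr xy] := h n; rewrite -lecR rmorphD /= -xs -yr.
  have /le_trans := ler_normD (x - y) y; rewrite subrK; apply.
  by rewrite addrC lerD2l.
have /le_trans := ler_normD (y - x) x; rewrite subrK; apply.
by rewrite addrC lerD2l distrC.
Qed.

Variables (W : nat -> R -> H -> H) (K : R).
Hypothesis K_ge0 : 0 <= K.
Hypothesis W_flow : forall k, flow (W k).
Hypothesis W_commute : forall i j s t x, W i s (W j t x) = W j t (W i s x).
Hypothesis W_lip : forall k t x,
  `|W k t x - x| <= (K * `|t| / 2 ^+ k)%:C * `|x|.

Let V := prod_flow W.

Let V_flow n : flow (V n).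
Proof. exact: prod_flowP. Qed.

Let V_cauchy t x X : `|x| = X%:C -> forall n k,
  `|V (n + k) t x - V n t x| <= ((2 * K * `|t| * X) / 2 ^+ n)%:C.
Proof.
move=> xX n k.
have X0 : 0 <= X by rewrite -ler0c -xX.
pose B := K * `|t| * X.
have B0 : 0 <= B by rewrite !mulr_ge0.
apply: (@le_trans _ _ ((2 * B) / 2 ^+ n - (2 * B) / 2 ^+ (n + k))%:C); last first.
  rewrite lecR /B !mulrA gerBl// divr_ge0 ?exprn_ge0//.
  by rewrite !mulr_ge0.
elim: k => [|k IHk].
  by rewrite addn0 !subrr normr0.
rewrite addnS /V /prod_flow /= -(subrKA (V (n + k) t x)).
apply: le_trans (ler_normD _ _) _.
apply: le_trans (lerD (W_lip _ _ _) IHk) _.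
have [_ ->] := flow_isometry (V_flow (n + k)) t.
rewrite xX -rmorphM -rmorphD lecR /= /B exprS.
have p0 : (2 : R) ^+ (n + k) != 0 by rewrite expf_neq0.
have q0 : (2 : R) ^+ n != 0 by rewrite expf_neq0.
move: (2 ^+ (n + k)) (2 ^+ n) p0 q0 => p q p0 q0.
rewrite le_eqVlt; apply/orP; left; apply/eqP; field.
by rewrite p0 q0.
Qed.

(** The partial products applied to a vector form a Cauchy sequence with
    geometric rate.  All flow axioms pass to the limit through the explicit
    estimate, which is also what later compares the flow with its partial products. *)
Theorem infinite_product_flow :
  exists U, flow U /\ forall n t x,
    `|U t x - prod_flow W n t x| <= (2 * K * `|t| / 2 ^+ n)%:C * `|x|.
Proof.
pose P (tx : (R * H)%type) (l : H) := forall n,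
  `|l - V n tx.1 tx.2| <= (2 * K * `|tx.1| / 2 ^+ n)%:C * `|tx.2|.
have Pex tx : exists l, P tx l.
  case: tx => t x; have [X X0 xX] := hilbert_normE x.
  have [l lV] := geometric_limit (V_cauchy t xX).
  exists l => n; rewrite xX -rmorphM /=; apply: le_trans (lV n) _.
  by rewrite lecR mulrAC.
have [U Ulim] := choice Pex.
have Ux t x X : `|x| = X%:C -> forall n,
    `|U (t, x) - V n t x| <= (2 * K * `|t| * X / 2 ^+ n)%:C.
  by move=> xX n; have := Ulim (t, x) n; rewrite /= xX -rmorphM /= [_ / _ * _]mulrAC.
exists (fun t x => U (t, x)); split; last by move=> n t x; exact: Ulim (t, x) n.
have Unorm t x : `|U (t, x)| = `|x|.
  have [X X0 xX] := hilbert_normE x; rewrite xX.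
  apply: (@norm_pow2 _ _ (2 * K * `|t| * X)) => n.
  exists (V n t x); last exact: Ux.
  by have [_ ->] := flow_isometry (V_flow n) t.
split.
- move=> t; split; last exact: Unorm.
  move=> c x y.
  have [X X0 xX] := hilbert_normE x; have [Y Y0 yY] := hilbert_normE y.
  have [Z Z0 zZ] := hilbert_normE (c *: x + y).
  have /complex_realP[c' cc'] := normr_real c.
  pose B := 2 * K * `|t|.
  apply: (@eq_pow2 _ _ (B * Z + (c' * (B * X) + B * Y))) => n.
  have [Vlin _] := flow_isometry (V_flow n) t.
  have -> : U (t, c *: x + y) - (c *: U (t, x) + U (t, y)) =
      U (t, c *: x + y) - V n t (c *: x + y) -
      (c *: (U (t, x) - V n t x) + (U (t, y) - V n t y)).
    rewrite Vlin scalerBr -[RHS]addrA -opprD; congr (_ - _).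
    by rewrite addrACA !(addrC _ (_ - _)) !subrK.
  apply: le_trans (ler_normB _ _) _; rewrite [(B * Z + _) / _]mulrDl rmorphD /=.
  apply: lerD; first exact: Ux.
  apply: le_trans (ler_normD _ _) _; rewrite mulrDl rmorphD /=.
  apply: lerD; last exact: Ux.
  rewrite normrZ cc' -mulrA rmorphM /= ler_wpM2l -?cc'//.
  exact: Ux.
- move=> x /=.
  have [X X0 xX] := hilbert_normE x.
  apply: (@eq_pow2 _ _ (2 * K * 0 * X)) => n.
  by have := Ux 0 x X xX n; rewrite normr0 (flow0 (V_flow n)).
- move=> s t x.
  have [X X0 xX] := hilbert_normE x.
  have UX : `|U (t, x)| = X%:C by rewrite Unorm.
  apply: (@eq_pow2 _ _ (2 * K * `|s + t| * X +
    (2 * K * `|t| * X + 2 * K * `|s| * X))) => n.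
  rewrite mulrDl rmorphD -(subrKA (V n (s + t) x)).
  apply: le_trans (ler_normD _ _) _; apply: lerD; first exact: Ux.
  rewrite flowD// -(subrKA (V n s (U (t, x)))) mulrDl rmorphD.
  apply: le_trans (ler_normD _ _) _; apply: lerD.
    rewrite isometry_dist; last exact: flow_isometry.
    by rewrite distrC; exact: Ux.
  by rewrite distrC; exact: Ux.
Qed.

End InfiniteProduct.

(** * Unitary operators and weak limits *)

Section Unitaries.
Variables (R : realType) (H : hilbertSpace R).
Local Notation C := R[i].
Local Notation dot := (inner H).

Lemma isometry_boundedOp (f : H -> H) : lin_isometry f ->
  exists T : boundedOp H, forall x, T x = f x.
Proof.
move=> [lf nf].
pose fL : {linear H -> H} := HB.pack f (GRing.isLinear.Build _ _ _ _ f lf).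
have fb : exists2 M : C, 0 <= M & forall x, `|fL x| <= M * `|x|.
  by exists 1 => // x; rewrite mul1r /= nf.
by exists (BoundedOp fb).
Qed.

(** The adjoint of W 1 is W (-1), and integral powers are integral times. *)
Lemma flow_unitary (W : R -> H -> H) : flow W ->
  exists U : unitaryOp H, forall (k : int) x, unitary_pow U k x = W k%:~R x.
Proof.
move=> fW.
have [S SW] := isometry_boundedOp (flow_isometry fW 1).
have [S' SW'] := isometry_boundedOp (flow_isometry fW (-1)).
have WK : cancel (W 1) (W (-1)) by move=> x; rewrite -flowD// addNr flow0.
have WK' : cancel (W (-1)) (W 1) by move=> x; rewrite -flowD// subrr flow0.
have adj x y : dot (S x) y = dot x (S' y).
  by rewrite SW SW' -{1}[y]WK' isometry_dot//; exact: flow_isometry.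
have SK : cancel S S' by move=> x; rewrite SW SW' WK.
have SK' : cancel S' S by move=> x; rewrite SW SW' WK'.
exists (UnitaryOp adj SK SK') => k x.
have powW (T : boundedOp H) (s : R) n :
    (forall y, T y = W s y) -> iter n (op_comp T) (op_id H) x = W (s * n%:R) x.
  move=> TW; elim: n => [|n IHn]; first by rewrite mulr0 flow0.
  by rewrite -natr1 mulrDr mulr1 addrC flowD// -IHn -TW.
case: k => n; first by rewrite /= (powW _ 1)// mul1r.
by rewrite [LHS](powW _ (-1))// NegzE mulN1r mulrNz.
Qed.

Lemma plim_cvg (Y : topologicalType) (p : set_system pnat) (u : pnat -> Y) l :
  Filter p -> plim p u l <-> u @ p --> l.
Proof.
move=> pF; split=> [h A|h O oO Ol].
  rewrite nbhsE => -[B [oB Bl] BA]; apply: filterS (h B oB Bl) => n.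
  exact: BA.
by apply: h; exact: open_nbhs_nbhs.
Qed.

(** Convergence for the coarsest topology making the matrix coefficients
    continuous is convergence of each coefficient. *)
Lemma plim_wotP (p : set_system pnat) (T : pnat -> boundedOp H) (S : boundedOp H) :
  Filter p ->
  plim p (T : pnat -> wot H) (S : wot H) <->
  forall x y (e : R), 0 < e ->
    p [set n | `|dot (T n x) y - dot (S x) y| < e%:C].
Proof.
move=> pF; rewrite plim_cvg; split=> [/cvg_sup h x y e e0|h].
  have oB : nbhs (dot (S x) y : C^o) [set z : C^o | `|z - dot (S x) y| < e%:C].
    have -> : [set z : C^o | `|z - dot (S x) y| < e%:C] =
        ball (dot (S x) y : C^o) e%:C.
      by apply/seteqP; split=> z; rewrite -ball_normE /= distrC.
    by apply: nbhsx_ballx; rewrite ltcR.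
  exact: h (x, y) _ (@initial_continuous (boundedOp H) C^o
    (fun Z : boundedOp H => dot (Z x) y) S _ oB).
apply/cvg_sup => -[x y] A [_ [[B oB <-] BS] BA].
have : nbhs (dot (S x) y : C^o) B by apply: open_nbhs_nbhs.
case/nbhs_ballP => eps /= /complex_gt0[e e0 ->] eB.
change (p [set n | A (T n)]).
apply: filterS (h x y e e0) => n ne; apply: BA; apply: eB.
by rewrite -ball_normE /= distrC.
Qed.

End Unitaries.

(** * A fast growing sequence and its finite sums *)

Section GapSequence.
Variables d N : nat.
Hypothesis d_gt0 : (0 < d)%N.
Local Open Scope nat_scope.

(** An auxiliary number that is a multiple of all earlier terms [gap l] and
    exceeds the sum of all of them; see [gap_dvdn_bound] and [fsum_bound]. *)
Fixpoint gap_bound k : nat :=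
  if k is j.+1 then
    let P := gap_bound j in let n := d * 2 ^ j * P ^ N in P * (1 + n) * n
  else 1.

(** The factor d makes all terms vanish modulo d, the factor 2^k gives summable
    errors, and the power of [gap_bound k] makes the term divisible by the
    N-th powers of the earlier ones and larger than the i-th powers, i <= N,
    of all sums of earlier ones. *)
Definition gap k : nat := d * 2 ^ k * gap_bound k ^ N.

Lemma gap_boundS k : gap_bound k.+1 = gap_bound k * (1 + gap k) * gap k.
Proof. by []. Qed.

Lemma gap_bound_gt0 k : 0 < gap_bound k.
Proof.
by elim: k => // k IHk; rewrite gap_boundS /gap !muln_gt0 IHk d_gt0 !expn_gt0 IHk.
Qed.

Lemma gap_gt0 k : 0 < gap k.
Proof. by rewrite /gap !muln_gt0 d_gt0 !expn_gt0 gap_bound_gt0. Qed.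

Lemma gap_ge_pow2 k : 2 ^ k <= gap k.
Proof.
rewrite /gap mulnAC; apply: leq_pmull.
by rewrite muln_gt0 d_gt0 expn_gt0 gap_bound_gt0.
Qed.

Lemma dvdn_gap k : d %| gap k.
Proof. by rewrite /gap -mulnA dvdn_mulr. Qed.

Lemma gap_dvdn_bound l k : l < k -> gap l %| gap_bound k.
Proof.
elim: k => // k IHk; rewrite ltnS leq_eqVlt gap_boundS => /predU1P[->|/IHk lk].
  exact: dvdn_mull.
by rewrite -mulnA dvdn_mulr.
Qed.

Lemma gap_dvdn_gap l k : l < k -> d * gap l ^ N %| gap k.
Proof.
move=> lk; rewrite {2}/gap; apply: dvdn_mul; first exact: dvdn_mulr.
by rewrite dvdn_exp2r//; exact: gap_dvdn_bound.
Qed.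

Definition fsum (F : pred nat) n : nat := \sum_(k < n | F k) gap k.

Lemma fsumS F n : fsum F n.+1 = fsum F n + F n * gap n.
Proof.
by rewrite /fsum big_mkcond big_ord_recr -big_mkcond /=; case: (F n); rewrite ?mul1n.
Qed.

Lemma fsum_bound F k : fsum F k < gap_bound k.
Proof.
elim: k => [|k IHk]; first by rewrite /fsum big_ord0.
rewrite fsumS gap_boundS.
apply: (@leq_trans (gap_bound k * (1 + gap k))); last by rewrite leq_pmulr ?gap_gt0.
rewrite mulnDr muln1 -addSn leq_add//; apply: leq_mul => //.
by case: (F k) => //; exact: gap_bound_gt0.
Qed.

Lemma dvdn_fsum F k : d %| fsum F k.
Proof. by apply: dvdn_sum => i _; exact: dvdn_gap. Qed.

Lemma fsum_eq0 F k : (forall l, l < k -> ~~ F l) -> fsum F k = 0.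
Proof. by move=> Fk; rewrite /fsum big1// => i; rewrite (negbTE (Fk _ _)). Qed.

(** The terms after the k-th are all multiples of d (gap k)^N. *)
Lemma fsum_split F n k : k < n -> exists w,
  fsum F n = fsum F k + F k * gap k + d * gap k ^ N * w.
Proof.
elim: n => // n IHn; rewrite ltnS leq_eqVlt => /predU1P[->|kn].
  by exists 0; rewrite muln0 addn0 fsumS.
have [w wE] := IHn kn; have /dvdnP[q qE] := gap_dvdn_gap kn.
exists (w + F n * q); rewrite fsumS wE qE mulnDr addnA; congr (_ + _).
by rewrite mulnA mulnC.
Qed.

(** The coefficients of the binomial expansion of (s + n)^i in powers of n: below
    n^j they contribute the small remainder u, above n^j a multiple of d n^j as d
    divides n, and at n^j a multiple of d n^j unless i = j, as d divides s.
    The induction on i replaces the expansion. *)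
Lemma pow_add_split s n i j : 0 < n -> d %| n -> d %| s ->
  exists u z, (s + n) ^ i = u + (i == j) * n ^ j + d * z * n ^ j /\
    u * n <= n ^ j * (1 + s) ^ i.
Proof.
move=> n_gt0 dn /dvdnP[q ->]; elim: i j => [|i IHi] [|j].
- by exists 0, 0; rewrite !expn0 !muln0 addn0 add0n.
- exists 1, 0; rewrite !expn0 muln0 mul1n muln1; split; first by rewrite !mul0n.
  by rewrite expnS; apply: leq_pmulr; rewrite expn_gt0 n_gt0.
- have /dvdnP[q' qE] : d %| (q * d + n) ^ i.+1.
    by rewrite expnS dvdn_mulr// dvdn_add// dvdn_mull.
  by exists 0, q'; split=> //; rewrite qE expn0 !muln1 mulnC.
have [u [z [e1 h1]]] := IHi j.+1; have [u' [z' [e2 h2]]] := IHi j.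
exists (q * d * u + n * u'), (q * d * z + z' + (i == j.+1) * q); split.
  rewrite expnS mulnDl {1}e1 {1}e2 eqSS !expnS; ring.
have h1' := leq_mul (leqnn (q * d)) h1; have h2' := leq_mul (leqnn n) h2.
apply: leq_trans (leq_trans (leq_add h1' h2') _).
  by rewrite leq_eqVlt; apply/orP; left; apply/eqP; ring.
by rewrite leq_eqVlt; apply/orP; left; apply/eqP; rewrite !expnS; ring.
Qed.

(** Dividing by (gap k)^j: the quotient is [k in F and i = j] modulo d, up to the
    remainder u / (gap k)^j <= (gap_bound k)^N / gap k <= 2^-k.  Indices before
    all of F have no remainder, so that the total error is governed by min F. *)
Lemma fsum_pow F n k i j : k < n -> 0 < i <= N -> 0 < j <= N ->
  exists u z,
    [/\ fsum F n ^ i = u + (F k && (i == j)) * gap k ^ j + d * z * gap k ^ j,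
        u * gap k <= gap k ^ j * gap_bound k ^ N &
        (forall l, l <= k -> ~~ F l) -> u = 0].
Proof.
move=> kn /andP[i_gt0 iN] /andP[j_gt0 jN].
have [w ->] := fsum_split F kn.
set s := fsum F k; set A := s + F k * gap k.
(* the terms after k change the power by a multiple of d (gap k)^j *)
have pow_mod m : exists w', (A + d * gap k ^ N * w) ^ m = A ^ m + d * gap k ^ j * w'.
  elim: m => [|m [w' IHm]]; first by exists 0; rewrite muln0.
  exists (gap k ^ (N - j) * w * A ^ m + A * w' + d * gap k ^ N * w * w').
  rewrite expnS IHm mulnDl !mulnDr -expnS -{1}(subnKC jN) expnD; ring.
have s_bound : (1 + s) ^ i <= gap_bound k ^ N.
  apply: (@leq_trans (gap_bound k ^ i)); first by rewrite leq_exp2r// fsum_bound.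
  by rewrite leq_pexp2l// gap_bound_gt0.
have [w' ->] := pow_mod i.
have [Fk|/negbTE Fk] := boolP (F k).
  have [u [z [e h]]] := pow_add_split i j (gap_gt0 k) (dvdn_gap k) (dvdn_fsum F k).
  exists u, (z + w'); split.
  - by rewrite /A Fk mul1n e /=; ring.
  - by apply: leq_trans h _; rewrite leq_mul2l s_bound orbT.
  - by move=> /(_ k (leqnn k)); rewrite Fk.
exists (s ^ i), w'; split.
- by rewrite /A Fk mul0n addn0 /=; ring.
- rewrite mulnC leq_mul//; first by rewrite -{1}(expn1 (gap k)) leq_pexp2l// gap_gt0.
  by apply: leq_trans s_bound; rewrite leq_exp2r// leq_addl.
- move=> Fl; rewrite /s fsum_eq0 ?exp0n// => l /ltnW; exact: Fl.
Qed.

End GapSequence.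

(** * The group of sequences of polynomials modulo G *)

Section CountableQuotient.
Variables (V : countZmodType) (S : zmodClosed V).

HB.instance Definition _ := Countable.copy (Quotient.quot S)
  (can_type (@reprK V (Quotient.quot S))).

End CountableQuotient.

Section CoefficientQuotient.
Variables (G : set {poly int}) .
Hypothesis G0 : G 0.
Hypothesis GB : forall P Q, G P -> G Q -> G (P - Q).

(** Sequences of polynomials are encoded as polynomials over [{poly int}]: the
    term at position k is the coefficient of degree k. *)
Definition coefs_in : {pred {poly {poly int}}} := fun b => `[< forall k, G b`_k >].

Fact coefs_in_zmod_closed : zmod_closed coefs_in.
Proof.
split; first by apply/asboolP => k; rewrite coef0.
by move=> a b /asboolP Ga /asboolP Gb; apply/asboolP => k; rewrite coefB; exact: GB.
Qed.

HB.instance Definition _ := GRing.isZmodClosed.Build _ coefs_in coefs_in_zmod_closed.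

Definition coef_quotient : countZmodType := Quotient.quot coefs_in.

Definition coef_class (b : {poly {poly int}}) : coef_quotient :=
  \pi_(Quotient.quot coefs_in)%qT b.

Fact coef_class_zmod_morphism : zmod_morphism coef_class.
Proof. exact: (raddfB (\pi_(Quotient.quot coefs_in)%qT)). Qed.

HB.instance Definition _ := GRing.isZmodMorphism.Build _ _ coef_class
  coef_class_zmod_morphism.

Lemma coef_class_eq0 b : coef_class b = 0 <-> forall k, G b`_k.
Proof.
have -> : (coef_class b = 0) = (coef_class b == coef_class 0).
  by rewrite raddf0; apply/propext; split=> /eqP.
rewrite /coef_class -Quotient.idealrBE subr0.
by split=> /asboolP.
Qed.

Lemma coef_class_surj (c : coef_quotient) : exists b, c = coef_class b.
Proof. by exists (repr c); rewrite /coef_class reprK. Qed.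

Lemma coefCXn (P : {poly int}) j k : (P%:P * 'X^j)`_k = if k == j then P else 0.
Proof.
by rewrite coefCM coefXn; case: eqP => _; rewrite ?mulr1 ?mulr0.
Qed.

Lemma coef_class_mono0 (P : {poly int}) j : G P -> coef_class (P%:P * 'X^j) = 0.
Proof. by move=> GP; apply/coef_class_eq0 => k; rewrite coefCXn; case: eqP. Qed.

Lemma coef_class_sum0 (P : {poly int}) (F : pred nat) n : G P ->
  coef_class (\sum_(k < n | F k) P%:P * 'X^k) = 0.
Proof.
by move=> GP; rewrite raddf_sum big1// => k _; exact: coef_class_mono0.
Qed.

(** A fixed class has a representative b that vanishes from some position on.
    If F lies beyond it, the difference has the coefficient P,
    outside G, at a point of F. *)
Lemma coef_class_avoid (P : {poly int}) (E : seq coef_quotient) : ~ G P ->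
  exists m, forall (F : pred nat) n, (forall k, F k -> (m <= k < n)%N) ->
    (exists k, F k) -> coef_class (\sum_(k < n | F k) P%:P * 'X^k) \notin E.
Proof.
move=> nGP; elim: E => [|c E [m mE]]; first by exists 0%N.
have [b cb] := coef_class_surj c.
exists (maxn m (size b)) => F n Fmn F_ne; rewrite inE negb_or; apply/andP; split.
  apply/eqP; rewrite cb => /eqP; rewrite -subr_eq0 -raddfB => /eqP.
  have [k Fk] := F_ne; have /andP[mk kn] := Fmn k Fk.
  move=> /coef_class_eq0/(_ k); rewrite coefB [b`_k]nth_default; last first.
    by apply: leq_trans mk; exact: leq_maxr.
  rewrite subr0 coef_sum (bigD1 (Ordinal kn))//= coefCXn eqxx big1 ?addr0//.
  move=> j /andP[_ jk]; rewrite coefCXn; case: eqP => // e.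
  by case/eqP: jk; apply: val_inj.
apply: mE => // k /Fmn/andP[mk ->]; rewrite andbT; apply: leq_trans mk.
exact: leq_maxl.
Qed.

End CoefficientQuotient.

(** * The flow attached to the sequence *)

Lemma geometric_tail (R : realFieldType) m n :
  \sum_(k < n) (if (m <= k)%N then 2^-1 ^+ k else 0) <= 2 * 2^-1 ^+ m :> R.
Proof.
have [nm|mn] := leqP n m.
  rewrite big1 => [|k _]; first by rewrite mulr_ge0 ?exprn_ge0.
  by rewrite leqNgt (leq_trans (ltn_ord k) nm).
have -> : \sum_(k < n) (if (m <= k)%N then 2^-1 ^+ k else 0) =
    2 * 2^-1 ^+ m - 2 * 2^-1 ^+ n :> R.
  rewrite -(subnKC (ltnW mn)); elim: (n - m)%N => [|j IHj].
    by rewrite addn0 subrr big1// => k _; rewrite leqNgt ltn_ord.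
  rewrite addnS big_ord_recr /= IHj leq_addr exprS.
  by move: (2^-1 ^+ (m + j)) (2^-1 ^+ m) => x y; field.
by rewrite gerBl mulr_ge0 ?exprn_ge0.
Qed.

Section FlowConstruction.
Variables (R : realType) (H : hilbertSpace R) (I : zmodType) (T : I -> H -> H).
Hypothesis T_iso : forall g, lin_isometry (T g).
Hypothesis T0 : T 0 =1 id.
Hypothesis TD : forall g h x, T (g + h) x = T g (T h x).
Variables (d N : nat) (g : nat -> nat -> I).
Hypothesis d_gt0 : (0 < d)%N.
Hypothesis g_order : forall k i, g k i *+ d = 0.
Local Notation C := R[i].
Local Notation gap := (gap d N).
Local Notation fsum := (fsum d N).

Lemma rep_commute a b x : T a (T b x) = T b (T a x).
Proof. by rewrite -!TD addrC. Qed.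

Lemma rep_iter a n x : iter n (T a) x = T (a *+ n) x.
Proof. by elim: n => [|n IHn]; rewrite ?T0// mulrS TD -IHn. Qed.

Lemma comp_upto_rep (a : nat -> I) n x :
  comp_upto (fun k => T (a k)) n x = T (\sum_(k < n) a k) x.
Proof.
elim: n => [|n IHn] /=; first by rewrite big_ord0 T0.
by rewrite big_ord_recr /= addrC TD IHn.
Qed.

Lemma flow_rescale (W : R -> H -> H) c : flow W -> flow (fun t => W (t / c)).
Proof.
move=> fW; split=> [t|x|s t x]; first exact: flow_isometry.
  by rewrite mul0r flow0.
by rewrite mulrDl flowD.
Qed.

(** The factor T_g(k, j + 1)^(t / n_k^(j + 1)) of the product; the index j starts
    from 0. *)
Definition gap_root k j (t : R) : H -> H :=
  root_flow d (T (g k j.+1)) (t / (gap k ^ j.+1)%:R).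

Definition gap_flow k : R -> H -> H := prod_flow (gap_root k) N.

Let T_order k i : iter d (T (g k i)) =1 id.
Proof. by move=> x; rewrite rep_iter g_order T0. Qed.

Let gap_root_flow k j : flow (gap_root k j).
Proof. by apply: flow_rescale; exact: root_flowP. Qed.

Let gap_root_commute k j k' j' s t x :
  gap_root k j s (gap_root k' j' t x) = gap_root k' j' t (gap_root k j s x).
Proof.
apply: root_flow_commute => [|y].
  by have [] := flow_isometry (gap_root_flow k j) s.
apply/esym; apply: root_flow_commute => [|z]; first by have [] := T_iso (g k' j'.+1).
exact: rep_commute.
Qed.

Let gap_flow_flow k : flow (gap_flow k).
Proof. by apply: prod_flowP => //; exact: gap_root_commute. Qed.

Let gap_flow_commute k k' s t x :
  gap_flow k s (gap_flow k' t x) = gap_flow k' t (gap_flow k s x).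
Proof.
apply: comp_upto_commute => j y _; apply/esym; apply: comp_upto_commute => j' z _.
exact: gap_root_commute.
Qed.

Let L : R := d%:R * (4 * pi).

Let L_ge0 : 0 <= L. Proof. by rewrite !mulr_ge0// pi_ge0. Qed.

Let gap_flow_lip k t x :
  `|gap_flow k t x - x| <= (N%:R * L * `|t| / 2 ^+ k)%:C * `|x|.
Proof.
(* the identity is compared with the product as a product of identities *)
have idE : comp_upto (fun _ => id) N x = x by elim: N.
rewrite -{2}idE; apply: le_trans
  (@comp_upto_close _ _ _ _ (fun=> L * `|t| / 2 ^+ k) _ _ _ _ _) _.
- by move=> j _; exact: flow_isometry.
- by move=> j _; exact: isometry_id.
- move=> j y _.
  apply: le_trans (root_flow_lipschitz d_gt0 (T_iso _) (@T_order _ _) _ _) _.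
  rewrite ler_wpM2r// lecR -/L -mulrA ler_wpM2l// normrM ler_wpM2l//.
  rewrite ger0_norm ?invr_ge0// lef_pV2 ?posrE ?ltr0n ?exprn_gt0 ?expn_gt0 ?gap_gt0//.
  rewrite -natrX ler_nat; apply: leq_trans (gap_ge_pow2 N d_gt0 k) _.
  by rewrite -{1}(expn1 (gap k)) leq_pexp2l// gap_gt0.
by rewrite sumr_const card_ord ler_wpM2r// lecR -[_ *+ N]mulr_natl !mulrA.
Qed.

Let gap_remainder k u j : (0 < j)%N ->
  (u * gap k <= gap k ^ j * gap_bound d N k ^ N)%N ->
  u%:R / (gap k ^ j)%:R <= 2^-1 ^+ k :> R.
Proof.
move=> j_gt0 h.
have gj : 0 < (gap k ^ j)%:R :> R by rewrite ltr0n expn_gt0 gap_gt0.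
rewrite ler_pdivrMr// exprVn mulrC ler_pdivlMr ?exprn_gt0// -natrX -natrM ler_nat.
rewrite -(@leq_pmul2r (gap_bound d N k ^ N)) ?expn_gt0 ?gap_bound_gt0//.
apply: leq_trans h; rewrite -mulnA leq_mul2l; apply/orP; right.
by rewrite /gap -mulnA leq_pmull.
Qed.

(** By [fsum_pow] the exponent is an integral multiple of the period d, plus 0 or 1,
    plus a remainder, which is small and vanishes when F starts after k. *)
Let gap_root_close F n i k j x : (k < n)%N -> (0 < i <= N)%N -> (j < N)%N ->
  `|gap_root k j (fsum F n ^ i)%:R x -
    T (if F k && (i == j.+1) then g k j.+1 else 0) x| <=
  (if [exists l : 'I_k.+1, F l] then L * 2^-1 ^+ k else 0)%:C * `|x|.
Proof.
move=> kn iN jN.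
have [u [z [fE u_le u0]]] := fsum_pow d_gt0 F kn iN (j := j.+1) jN.
set delta := F k && (i == j.+1) in fE *.
have fW : flow (root_flow d (T (g k j.+1))) by exact: root_flowP.
have gj : (gap k ^ j.+1)%:R != 0 :> R by rewrite pnatr_eq0 -lt0n expn_gt0 gap_gt0.
have -> : gap_root k j (fsum F n ^ i)%:R x =
    root_flow d (T (g k j.+1)) (u%:R / (gap k ^ j.+1)%:R)
      (T (if delta then g k j.+1 else 0) x).
  rewrite /gap_root fE.
  have -> : (u + delta * gap k ^ j.+1 + d * z * gap k ^ j.+1)%:R /
      (gap k ^ j.+1)%:R =
      u%:R / (gap k ^ j.+1)%:R + (delta%:R + d%:R * z%:Z%:~R) :> R.
    rewrite 2!natrD 3!natrM; move: ((gap k ^ j.+1)%:R) gj => G G0.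
    by field.
  rewrite flowD//; congr root_flow; rewrite flowD// root_flow_period//.
  by case: delta {fE}; rewrite ?root_flow1// flow0// T0.
apply: le_trans (root_flow_lipschitz d_gt0 (T_iso _) (@T_order _ _) _ _) _.
have [_ ->] := T_iso (if delta then g k j.+1 else 0).
rewrite ler_wpM2r// lecR -/L ger0_norm ?divr_ge0//.
case: existsP => [_|nF]; first by rewrite ler_wpM2l// gap_remainder.
rewrite u0 ?mul0r ?mulr0// => l lk; apply/negP => Fl; apply: nF.
by exists (Ordinal (lk : (l < k.+1)%N)).
Qed.

(** The errors 2^-k of the factors with k >= min F add up to O(2^-m).  The
    comparison is made with a partial product of arbitrary length and then passed to
    the limit. *)
Theorem exists_flow : exists (U : R -> H -> H) (K : R),
  [/\ flow U, 0 <= K &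
    forall (F : pred nat) n m i x, (0 < i <= N)%N ->
      (forall k, F k -> (m <= k < n)%N) ->
      `|U (fsum F n ^ i)%:R x - T (\sum_(k < n | F k) g k i) x| <=
        (K / 2 ^+ m)%:C * `|x|].
Proof.
have [U [fU UV]] := infinite_product_flow (mulr_ge0 (ler0n _ N) L_ge0)
  gap_flow_flow gap_flow_commute gap_flow_lip.
exists U, (N%:R * L * 2); split=> //; first by rewrite mulr_ge0// mulr_ge0// L_ge0.
move=> F n m i x iN Fmn.
have [X X0 xX] := hilbert_normE x.
pose t : R := (fsum F n ^ i)%:R.
have V_close n' : (n <= n')%N ->
    `|prod_flow gap_flow n' t x - T (\sum_(k < n | F k) g k i) x| <=
      (N%:R * L * 2 / 2 ^+ m)%:C * `|x|.
  move=> nn'.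
  have FE k : F k && (k < n)%N = F k.
    by apply: andb_idr => /Fmn/andP[].
  have fE : fsum F n = fsum F n'.
    rewrite /fsum (big_ord_widen_cond n' F gap nn').
    by apply: eq_bigl => k; exact: FE.
  pose a k j := if F k && (i == j.+1) then g k j.+1 else 0.
  (* the translation is a product over k and j of factors, at most one of which is
     nontrivial for each k *)
  have -> : T (\sum_(k < n | F k) g k i) x =
      comp_upto (fun k => T (\sum_(j < N) a k j)) n' x.
    rewrite comp_upto_rep (big_ord_widen_cond n' F (fun k => g k i) nn').
    rewrite big_mkcond; congr (T _ x); apply: eq_bigr => k _; rewrite FE /a.
    case: (F k) => /=; last by rewrite big1.
    have /andP[i_gt0 iN'] := iN.
    have i1N : (i.-1 < N)%N by rewrite prednK.
    rewrite (bigD1 (Ordinal i1N))//= prednK// eqxx big1 ?addr0// => j ji.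
    case: eqP => // ij; case/eqP: ji; apply: val_inj; by rewrite /= ij.
  apply: le_trans (@comp_upto_close _ _ _ _
    (fun k => if (m <= k)%N then N%:R * L * 2^-1 ^+ k else 0) _ _ _ _ _) _.
  - by move=> k _; exact: flow_isometry.
  - by move=> k _; exact: T_iso.
  - move=> k y kn'; rewrite -comp_upto_rep.
    apply: le_trans (@comp_upto_close _ _ _ _
      (fun=> if [exists l : 'I_k.+1, F l] then L * 2^-1 ^+ k else 0) _ _ _ _ _) _.
    + by move=> j _; exact: flow_isometry.
    + by move=> j _; exact: T_iso.
    + by move=> j z jN; rewrite /t fE; exact: gap_root_close.
    rewrite ler_wpM2r// lecR sumr_const card_ord.
    case: existsP => [[l Fl]|_]; last by rewrite mul0rn; case: ifP => // _;
      rewrite mulr_ge0 ?exprn_ge0// mulr_ge0// L_ge0.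
    have /andP[ml _] := Fmn _ Fl.
    have lk : (l <= k)%N by rewrite -ltnS ltn_ord.
    by rewrite (leq_trans ml lk) -[_ *+ N]mulr_natl mulrA.
  rewrite ler_wpM2r// lecR -mulrA -exprVn.
  under eq_bigr => k _ do rewrite -[0](mulr0 (N%:R * L)) -fun_if.
  rewrite -mulr_sumr ler_wpM2l ?geometric_tail//; exact: mulr_ge0.
have [B BE] : exists B : R, B = N%:R * L * 2 / 2 ^+ m by eexists.
rewrite -BE in V_close *; rewrite -/t.
have [Y Y0 yY] := hilbert_normE (U t x - T (\sum_(k < n | F k) g k i) x).
rewrite yY xX -rmorphM lecR /=.
apply: (@ler_pow2 _ _ (2 * (N%:R * L) * `|t| * X)) => n0.
rewrite -lecR -yY rmorphD /=.
have -> : U t x - T (\sum_(k < n | F k) g k i) x =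
    (prod_flow gap_flow (n + n0) t x - T (\sum_(k < n | F k) g k i) x) +
    (U t x - prod_flow gap_flow (n + n0) t x) by rewrite [RHS]addrC subrKA.
apply: le_trans (ler_normD _ _) _; apply: lerD.
  by rewrite rmorphM /= -xX V_close// leq_addr.
apply: le_trans (UV _ _ _) _; rewrite xX -rmorphM lecR /= [leLHS]mulrAC.
have c0 : 0 <= 2 * (N%:R * L) * `|t| * X.
  by rewrite mulr_ge0// mulr_ge0// mulr_ge0// mulr_ge0// L_ge0.
rewrite (ler_wpM2l c0)// lef_pV2 ?posrE ?exprn_gt0// ler_eXn2l ?ltr1n//.
exact: leq_addl.
Qed.

End FlowConstruction.

(** * From monomials to polynomials *)

Section Approximation.
Variables (R : realType) (H : hilbertSpace R) (I : zmodType).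
Variables (U : R -> H -> H) (T : I -> H -> H).
Hypothesis U_flow : flow U.
Hypothesis T_iso : forall g, lin_isometry (T g).
Hypothesis T0 : T 0 =1 id.
Hypothesis TD : forall g h x, T (g + h) x = T g (T h x).

Definition approx (e : R) (m : int) (g : I) : Prop :=
  forall x, `|U m%:~R x - T g x| <= e%:C * `|x|.

Lemma approx0 : approx 0 0 0.
Proof. by move=> x; rewrite (flow0 U_flow) T0 subrr normr0 mul0r. Qed.

Lemma approxD e e' m m' g g' :
  approx e m g -> approx e' m' g' -> approx (e + e') (m + m') (g + g').
Proof.
move=> h h' x; rewrite rmorphD /= flowD// TD -(subrKA (U m%:~R (T g' x))).
apply: le_trans (ler_normD _ _) _; rewrite rmorphD mulrDl addrC lerD//.
  by apply: le_trans (h _) _; have [_ ->] := T_iso g'.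
by rewrite isometry_dist; [exact: h'|exact: flow_isometry].
Qed.

Lemma approxN e m g : approx e m g -> approx e (- m) (- g).
Proof.
move=> h x; have [_ nT] := T_iso (- g).
have xE : x = U m%:~R (U (- m)%:~R x).
  by rewrite -flowD// -rmorphD subrr (flow0 U_flow).
have TK y : T (- g) (T g y) = y by rewrite -TD addNr T0.
rewrite {2}xE -[U (- m)%:~R x in X in `|X - _|](TK (U (- m)%:~R x)).
rewrite isometry_dist// distrC; apply: le_trans (h _) _.
by have [_ ->] := flow_isometry U_flow (- m)%:~R.
Qed.

Lemma approxMz e m g (q : int) :
  approx e m g -> approx (`|q|%N%:R * e) (q * m) (g *~ q).
Proof.
move=> h.
have hn n : approx (n%:R * e) (n%:Z * m) (g *~ n%:Z).
  elim: n => [|n IHn]; first by rewrite !mul0r mulr0z; exact: approx0.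
  by rewrite -natr1 mulrDl mul1r -[n.+1%:Z]/(n.+1%N : int) -addn1 PoszD mulrDl mul1r
    mulrzDr mulr1z; exact: approxD.
case: q => n; first exact: hn.
by rewrite NegzE abszN mulNr mulrNz; exact/approxN/hn.
Qed.

Lemma approx_sum n (e : nat -> R) (m : nat -> int) (g : nat -> I) :
  (forall i, (i < n)%N -> approx (e i) (m i) (g i)) ->
  approx (\sum_(i < n) e i) (\sum_(i < n) m i) (\sum_(i < n) g i).
Proof.
elim: n => [|n IHn] h; first by rewrite !big_ord0; exact: approx0.
rewrite !big_ord_recr; apply: approxD; last exact: h.
by apply: IHn => i /ltnW; exact: h.
Qed.

End Approximation.

Lemma intpolys_coef0 N P : intpolys N P -> P`_0 = 0.
Proof. by move=> [P0 _]; rewrite -horner_coef0. Qed.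

Section FiniteSums.
Variables d N : nat.
Hypothesis d_gt0 : (0 < d)%N.
Local Notation gap := (gap d N).
Local Notation fsum := (fsum d N).

(** The finite sums of terms of index at least m, as positive integers: these
    sets generate the filter from which the idempotent is obtained. *)
Definition tail_sums m : set pnat :=
  [set y | exists (F : pred nat) n,
    (forall k, F k -> (m <= k < n)%N) /\ val y = fsum F n].

Lemma fsum_widen (F : pred nat) n n' : (n <= n')%N ->
  (forall k, F k -> (k < n)%N) -> fsum F n = fsum F n'.
Proof.
move=> nn' Fn; rewrite /fsum (big_ord_widen_cond n' F gap nn').
by apply: eq_bigl => k; apply: andb_idr; exact: Fn.
Qed.

Lemma tail_sums_neq0 m : tail_sums m !=set0.
Proof.
have s0 : (0 < fsum (pred1 m) m.+1)%N.
  by rewrite fsumS /= eqxx mul1n addn_gt0 gap_gt0// orbT.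
exists (exist (fun n => (0 < n)%N) _ s0), (pred1 m), m.+1; split=> // k /eqP ->.
by rewrite leqnn ltnSn.
Qed.

Lemma tail_sums_decreasing m n : (m <= n)%N -> tail_sums n `<=` tail_sums m.
Proof.
move=> mn y [F [l [Fl yl]]]; exists F, l; split=> // k /Fl/andP[nk ->].
by rewrite (leq_trans mn).
Qed.

(** Once the terms of y start after those of n, the sum y + n has no repeated term. *)
Lemma tail_sums_add m n : tail_sums m n ->
  exists m', forall y, tail_sums m' y -> tail_sums m (addp y n).
Proof.
move=> [F [l [Fl nl]]]; exists (maxn m l) => y [F' [l' [Fl' yl']]].
exists [pred k | F k || F' k], (maxn l l'); split=> [k /orP[/Fl|/Fl']/andP[k1 k2]|].
- by rewrite k1 leq_max k2.
- rewrite (leq_trans (leq_maxl _ _) k1) leq_max k2 orbT//.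
have -> : val (addp y n) = (val n + val y)%N by rewrite /= addnC.
rewrite nl yl' (@fsum_widen F _ (maxn l l')) ?leq_maxl//; last by move=> k /Fl/andP[].
rewrite (@fsum_widen F' _ (maxn l l')) ?leq_maxr//; last by move=> k /Fl'/andP[].
rewrite /fsum big_mkcond [in X in (_ + X)%N]big_mkcond [RHS]big_mkcond.
rewrite -big_split; apply: eq_bigr => k _ /=.
have [Fk|_] /= := boolP (F k); last by rewrite add0n.
have [F'k|_] := boolP (F' k); last by rewrite addn0.
have /andP[+ _] := Fl' k F'k; rewrite geq_max => /andP[_].
by have /andP[_ kl] := Fl k Fk; rewrite leqNgt kl.
Qed.

(** The elements of [pnat] are positive, which excludes the empty sum. *)
Lemma fsum_support (y : pnat) (F : pred nat) n :
  val y = fsum F n -> exists k : nat, F k.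
Proof.
move=> yF; apply: contrapT => nF; have := valP y; rewrite yF fsum_eq0// => k _.
by apply/negP => Fk; apply: nF; exists k.
Qed.

End FiniteSums.

Lemma sum_mulrz (V : zmodType) n (P : pred 'I_n) (f : 'I_n -> V) (q : int) :
  (\sum_(i < n | P i) f i) *~ q = \sum_(i < n | P i) f i *~ q.
Proof.
by apply: (big_morph (fun x => x *~ q)) => [x y|]; rewrite ?mulrzDl ?mul0rz.
Qed.

Section Construction.
Variables (R : realType) (N d : nat) (G : set {poly int}).
Hypothesis d_gt0 : (0 < d)%N.
Hypothesis hG : subgroup_of (intpolys N) G.
Hypothesis dG : forall P, intpolys N P -> G (P *+ d).

Let G0 : G 0. Proof. by case: hG. Qed.
Let GB P Q : G P -> G Q -> G (P - Q). Proof. by case: hG => _ _; apply. Qed.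

Local Notation Gamma := (coef_quotient G0 GB).
Local Notation cls := (coef_class G0 GB).

(** Setting the monomials of degree outside [1, N] to 0 makes all classes
    [g k i] of order dividing d, whatever i is. *)
Definition mono i : {poly int} := if (0 < i <= N)%N then 'X^i else 0.

Lemma intpolys_mono i : intpolys N (mono i).
Proof.
rewrite /mono; case: ifP => [/andP[i0 iN]|_]; last first.
  by split; rewrite ?horner0 ?size_poly0.
by split; rewrite ?hornerXn ?expr0n ?gtn_eqF// size_polyXn.
Qed.

Let g k i : Gamma := cls ((mono i)%:P * 'X^k).

Let g_order k i : g k i *+ d = 0.
Proof.
rewrite /g -raddfMn -mulrnAl -polyCMn; apply: coef_class_mono0.
exact/dG/intpolys_mono.
Qed.

Lemma coef_mono i j : (mono i)`_j = ((0 < i <= N)%N && (j == i))%:R.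
Proof. by rewrite /mono; case: ifP => _; rewrite ?coef0 ?coefXn. Qed.

Lemma intpolys_sum P : intpolys N P -> P = \sum_(i < N.+1) mono i *~ P`_i.
Proof.
move=> PN; have [_ sP] := PN; apply/polyP => j; rewrite coef_sum.
under eq_bigr do rewrite coefMrz coef_mono.
have [Nj|jN] := ltnP N j.
  rewrite nth_default ?(leq_trans sP)// big1// => i _.
  by rewrite gtn_eqF ?andbF ?mul0rz// (leq_trans (ltn_ord i)).
rewrite (bigD1 (Ordinal (jN : (j < N.+1)%N)))//= eqxx andbT jN andbT big1 ?addr0.
  case: posnP => [->|_]; last by rewrite intz.
  by rewrite mul0rz (intpolys_coef0 PN).
move=> i ij; case: eqP => [e|_]; last by rewrite andbF mul0rz.
by case/eqP: ij; apply: val_inj.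
Qed.

(** For Q in P_N the integer Q(n_F) is a combination of the n_F^i, so U(Q(n_F))
    is close to the translation by the class of the sequence equal to Q on F. *)
Theorem flow_limits :
  exists (H : hilbertSpace R) (p : set_system pnat) (U : unitaryOp H),
  [/\ idempotent_ultrafilter p,
      exists x : H, x != 0,
      forall P, G P -> poly_wot_lim p U P (op_id H) &
      forall Q, intpolys N Q -> ~ G Q -> poly_wot_lim p U Q (op_zero H)].
Proof.
have [H [T [T_iso T0 TD H_neq0 T_c0]]] := c0_representation R Gamma.
have [p [p_idem pB]] := idempotent_ultrafilter_exists (tail_sums_neq0 N d_gt0)
  (@tail_sums_decreasing d N) (@tail_sums_add d N).
have [W [K [W_flow K0 WK]]] := exists_flow T_iso T0 TD N d_gt0 g_order.
have [U UW] := flow_unitary W_flow.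
have [pU _] := p_idem.
exists H, p, U.
have W_close P : intpolys N P -> exists2 B, 0 <= B &
    forall (F : pred nat) n m, (forall k, F k -> (m <= k < n)%N) ->
    approx W T (B / 2 ^+ m) P.[(fsum d N F n)%:Z]
      (cls (\sum_(k < n | F k) P%:P * 'X^k)).
  move=> PN; exists (\sum_(i < N.+1) (absz P`_i)%:R * K).
    by apply: sumr_ge0 => i _; rewrite mulr_ge0.
  move=> F n m Fmn.
  have -> : P.[(fsum d N F n)%:Z] = \sum_(i < N.+1) P`_i * (fsum d N F n)%:Z ^+ i.
    by apply: horner_coef_wide; case: PN.
  have -> : cls (\sum_(k < n | F k) P%:P * 'X^k) =
      \sum_(i < N.+1) (\sum_(k < n | F k) g k i) *~ P`_i.
    rewrite raddf_sum /=; under [RHS]eq_bigr do rewrite sum_mulrz.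
    rewrite [RHS]exchange_big; apply: eq_bigr => k _.
    rewrite {1}(intpolys_sum PN) raddf_sum mulr_suml raddf_sum.
    by apply: eq_bigr => i _; rewrite /g -raddfMz /= -mulrzAl -(raddfMz polyC).
  rewrite mulr_suml.
  apply: (@approx_sum _ _ _ _ _ W_flow T_iso T0 TD N.+1
    (fun i => (absz P`_i)%:R * K / 2 ^+ m)
    (fun i => P`_i * (fsum d N F n)%:Z ^+ i)
    (fun i => (\sum_(k < n | F k) g k i) *~ P`_i)) => i iN.
  have [->|i0] := posnP i.
    rewrite (intpolys_coef0 PN) !mul0r mulr0z; exact: approx0.
  rewrite -mulrA; apply: approxMz => // x.
  have -> : ((fsum d N F n)%:Z ^+ i)%:~R = (fsum d N F n ^ i)%:R :> R.
    by rewrite rmorphXn /= natrX.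
  by apply: WK => //; rewrite i0 -ltnS.
split=> //.
- move=> P GP; apply/plim_wotP => x y e e0.
  have PN : intpolys N P by case: hG => + _ _; apply.
  have [B B0 WP] := W_close P PN.
  have [X X0 xX] := hilbert_normE x; have [Y Y0 yY] := hilbert_normE y.
  have [m Bm] := pow2_small (B * X * Y) e0.
  apply: filterS (pB m) => n [F [l [Fl nF]]] /=.
  have := WP F l m Fl x; rewrite coef_class_sum0// T0 -nF -UW.
  move=> h; rewrite -linearBl /=.
  apply: le_lt_trans (inner_CauchySchwarz _ _) _.
  rewrite yY; apply: (@le_lt_trans _ _ ((B * X * Y / 2 ^+ m)%:C)).
    rewrite [(B * _ * _ / _)]mulrAC rmorphM ler_wpM2r ?ler0c//.
    by rewrite mulrAC rmorphM /= -xX.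
  by rewrite ltcR.
- move=> Q QN nGQ; apply/plim_wotP => x y e e0.
  have e20 : 0 < e / 2 by rewrite divr_gt0.
  have [B B0 WP] := W_close Q QN.
  have [X X0 xX] := hilbert_normE x; have [Y Y0 yY] := hilbert_normE y.
  have [m Bm] := pow2_small (B * X * Y) e20.
  have [E TE] := T_c0 x y _ e20.
  have [m' avoid] := coef_class_avoid E nGQ.
  (* m makes the approximation good, m' sends the class out of E *)
  apply: filterS (pB (maxn m m')) => n [F [l [Fl nF]]] /=.
  have Fm k : F k -> (m <= k < l)%N.
    by move=> /Fl/andP[Mk ->]; rewrite (leq_trans (leq_maxl _ _) Mk).
  have Fm' k : F k -> (m' <= k < l)%N.
    by move=> /Fl/andP[Mk ->]; rewrite (leq_trans (leq_maxr _ _) Mk).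
  have gE := avoid F l Fm' (fsum_support nF).
  have := WP F l m Fm x; rewrite -nF -UW.
  set c := cls _ in gE * => h.
  rewrite linear0l subr0 -[inner H _ y](subrK (inner H (T c x) y)).
  apply: le_lt_trans (ler_normD _ _) _.
  rewrite [e in ltRHS]splitr rmorphD ltr_leD//; last exact: TE.
  rewrite -linearBl /=.
  apply: le_lt_trans (inner_CauchySchwarz _ _) _.
  rewrite yY; apply: (@le_lt_trans _ _ ((B * X * Y / 2 ^+ m)%:C)).
    rewrite [(B * _ * _ / _)]mulrAC rmorphM ler_wpM2r ?ler0c//.
    by rewrite mulrAC rmorphM /= -xX.
  by rewrite ltcR.
Qed.

End Construction.

(** * Differences of polynomials and finite index *)

Lemma coef_XaddC_exp (c : int) i n :
  (('X + c%:P) ^+ i)`_n = (c ^+ (i - n)) *+ 'C(i, n).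
Proof.
elim: i n => [|i IHi] n.
  by rewrite expr0 coef1; case: n => [|n]; rewrite ?bin0 ?bin0n.
rewrite exprS mulrDl coefD coefXM coefCM; case: n => [|n] /=.
  by rewrite add0r IHi !bin0 !subn0 exprS !mulr1n.
rewrite !IHi subSS binS mulrnDr addrC; congr (_ + _).
have [ni|ni] := ltnP n i; last by rewrite bin_small// !mulr0n mulr0.
by rewrite mulrnAr -exprS subnSK.
Qed.

Definition shift_poly (P : {poly int}) (c : int) : {poly int} :=
  P \Po ('X + c%:P) - P.[c]%:P.

Lemma horner_shift_poly P c y : (shift_poly P c).[y] = P.[y + c] - P.[c].
Proof. by rewrite /shift_poly !hornerE horner_comp !hornerE. Qed.

(** Only the two leading terms of P reach degree k in P(x + c) - P(c) - P(x): the
    coefficient is that of the derivative, up to the factor c. *)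
Lemma coef_shift_poly (P : {poly int}) c k : (0 < k)%N -> (size P <= k.+2)%N ->
  (shift_poly P c - P)`_k = P`_k.+1 * (c *+ k.+1).
Proof.
move=> k0 sP; rewrite /shift_poly !coefB coefC gtn_eqF// subr0.
rewrite coef_comp_poly -(big_mkord xpredT (fun i => P`_i * (('X + c%:P) ^+ i)`_k)).
have -> : \sum_(0 <= i < size P) P`_i * (('X + c%:P) ^+ i)`_k =
    \sum_(0 <= i < k.+2) P`_i * (('X + c%:P) ^+ i)`_k.
  rewrite [RHS](@big_cat_nat _ _ _ (size P))//= -[LHS]addr0; congr (_ + _).
  by rewrite big_nat big1// => i /andP[si _]; rewrite nth_default// mul0r.
rewrite !big_nat_recr//= big_nat big1; last first.
  by move=> i /andP[_ ik]; rewrite coef_XaddC_exp bin_small// mulr0n mulr0.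
rewrite add0r !coef_XaddC_exp subnn binn subSnn expr0 expr1 mulr1n mulr1.
by rewrite binSn addrAC subrr add0r.
Qed.

Lemma size_shift_poly (P : {poly int}) c k : (size P <= k.+2)%N -> (0 < k)%N ->
  (size (shift_poly P c - P)%R <= k.+1)%N.
Proof.
move=> sP k0; apply/leq_sizeP => j kj.
have j1 : (size P <= j.+1)%N by exact: leq_trans sP _.
rewrite coef_shift_poly ?nth_default ?mul0r//; first exact: leq_trans kj.
exact: ltnW.
Qed.

Lemma intpolys_shift N P c : intpolys N P -> intpolys N (shift_poly P c).
Proof.
move=> [P0 sP]; split; first by rewrite horner_shift_poly add0r subrr.
rewrite /shift_poly (leq_trans (size_polyD _ _))// geq_max size_polyN.
rewrite size_comp_poly2 ?size_XaddC// sP (leq_trans (size_polyC_leq1 _))//.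
Qed.

Section FiniteIndex.
Variables (N : nat) (G : set {poly int}).
Hypothesis hG : subgroup_of (intpolys N) G.

Let G0 : G 0. Proof. by case: hG. Qed.
Let GB P Q : G P -> G Q -> G (P - Q). Proof. by case: hG => _ _; apply. Qed.
Let GN P : G P -> G (- P). Proof. by move=> GP; rewrite -sub0r; exact: GB. Qed.
Let GD P Q : G P -> G Q -> G (P + Q).
Proof. by move=> GP GQ; rewrite -[Q]opprK; apply: GB => //; exact: GN. Qed.
Let GMz P (q : int) : G P -> G (P *~ q).
Proof.
move=> GP; have GMn n : G (P *+ n).
  by elim: n => [|n IHn]; rewrite ?mulr0n// mulrS; exact: GD.
by case: q => n; [exact: GMn|rewrite NegzE mulrNz; exact/GN/GMn].
Qed.

(** Division with remainder of the coefficient of degree k + 1 by that of an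
    element of G of the same degree leaves finitely many possible remainders. *)
Lemma finite_representatives :
  (forall k, (k < N)%N -> exists2 P, G P & size P = k.+2) ->
  forall k, (k <= N)%N -> exists L : seq {poly int},
    forall Q, intpolys k Q -> exists2 r, r \in L & G (Q - r).
Proof.
move=> Gdeg; elim=> [_|k IHk kN].
  exists [:: 0] => Q [Q0 sQ]; exists 0; rewrite ?inE//.
  rewrite subr0 (size1_polyC sQ) -horner_coef0 Q0 polyC0; exact: G0.
have [L hL] := IHk (ltnW kN); have [P GP sP] := Gdeg k kN.
have GPN : intpolys N P by case: hG => + _ _; apply.
pose a := P`_k.+1.
have a0 : a != 0.
  by rewrite /a -[k.+1]/(k.+2.-1) -sP -lead_coefE lead_coef_eq0 -size_poly_gt0 sP.
exists [seq r + 'X^(k.+1) *~ s%:Z | r <- L, s <- iota 0 `|a|%N] => Q [Q0 sQ].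
pose c := Q`_k.+1; pose s := (c %% a)%Z; pose q := (c %/ a)%Z.
have s_nat : s = `|s|%N%:Z by rewrite gez0_abs// modz_ge0.
(* Q' is Q after one division step; its degree is at most k *)
pose Q' := Q - P *~ q - 'X^(k.+1) *~ s.
have Q'k : intpolys k Q'.
  split.
    rewrite /Q' !hornerE Q0 !hornerMz.
    have [-> _] := GPN.
    by rewrite hornerXn expr0n/= !mul0rz subrr.
  apply/leq_sizeP => j kj; rewrite /Q' !coefB !coefMrz coefXn.
  move: kj; rewrite leq_eqVlt => /predU1P[<-|kj].
    rewrite eqxx -/a -/c mulrzz intz [X in X - _ - _](divz_eq c a) -/q -/s; ring.
  rewrite !nth_default ?sP ?(leq_trans sQ)// gtn_eqF// !mul0rz subrr//.
have [r rL Gr] := hL _ Q'k.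
exists (r + 'X^(k.+1) *~ s).
  apply/allpairsP; exists (r, `|s|%N); split=> //=; last by rewrite -s_nat.
  by rewrite mem_iota /= add0n -ltz_nat -s_nat; have := ltz_mod c a0; rewrite -abszE.
have -> : Q - (r + 'X^(k.+1) *~ s) = (Q' - r) + P *~ q.
  by rewrite /Q'; ring.
by apply: GD => //; exact: GMz.
Qed.

Lemma finite_index_of_degrees :
  (forall k, (k < N)%N -> exists2 P, G P & size P = k.+2) ->
  finite_index (intpolys N) G.
Proof.
move=> /finite_representatives/(_ N (leqnn N))[L hL].
apply: (@sub_finite_set _ _ ((fun r => [set r + g | g in G]) @` [set` L])).
  move=> C [Q QN ->]; have [r rL Gr] := hL Q QN; exists r => //.
  apply/seteqP; split=> _ [P GP <-].
    by exists (P - (Q - r)); [exact: GB|rewrite /=; ring].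
  by exists (P + (Q - r)); [exact: GD|rewrite /=; ring].
exact/finite_image/finite_seq.
Qed.

End FiniteIndex.

(** * Rigidity passes to differences *)

Section UnitaryPowers.
Variables (R : realType) (H : hilbertSpace R) (U : unitaryOp H).
Local Notation adj := (unitary_adj U).

Lemma unitary_powD1 (k : int) x : unitary_pow U (k + 1) x = U (unitary_pow U k x).
Proof.
case: k => n; first by rewrite -PoszD addn1.
case: n => [|n]; first by rewrite /= unitary_adjK.
have -> : Negz n.+1 + 1 = Negz n by rewrite !NegzE -[n.+2]addn1 PoszD opprD addrNK.
by rewrite /= unitary_adjK.
Qed.

Lemma unitary_powB1 (k : int) x : unitary_pow U (k - 1) x = adj (unitary_pow U k x).
Proof. by rewrite -{2}(subrK 1 k) unitary_powD1 unitary_opK. Qed.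

Lemma unitary_powD (k l : int) x :
  unitary_pow U (k + l) x = unitary_pow U k (unitary_pow U l x).
Proof.
elim/int_rect: k => [|n IHn|n IHn]; first by rewrite add0r.
  have -> : n.+1%:Z + l = n%:Z + l + 1 by rewrite -addn1 PoszD addrAC.
  by rewrite unitary_powD1 IHn -unitary_powD1 -PoszD addn1.
have -> : - n.+1%:Z + l = - n%:Z + l - 1 by rewrite -addn1 PoszD opprD addrAC.
by rewrite unitary_powB1 IHn -unitary_powB1 -opprD -PoszD addn1.
Qed.

Lemma unitary_isometry : lin_isometry U.
Proof.
split; first exact: linearP.
move=> x; apply/eqP; rewrite -(@eqrXn2 _ 2)//.
by rewrite !inner_normE unitary_adjP unitary_opK.
Qed.

Lemma unitary_pow_isometry (k : int) : lin_isometry (unitary_pow U k).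
Proof.
split; first exact: linearP.
move=> x; elim/int_rect: k => [|n IHn|n IHn] //.
  by rewrite -addn1 PoszD unitary_powD1; have [_ ->] := unitary_isometry.
rewrite -IHn -addn1 PoszD opprD unitary_powB1.
by have [_ <-] := unitary_isometry; rewrite unitary_adjK.
Qed.

Lemma unitary_pow_dot (k : int) x y :
  inner H (unitary_pow U k x) y = inner H x (unitary_pow U (- k) y).
Proof.
rewrite -[RHS](isometry_dot _ _ (unitary_pow_isometry k)).
by rewrite -unitary_powD subrr.
Qed.

Lemma id_zero_limits_disjoint (p : set_system pnat) (x : H) (P : {poly int}) :
  ProperFilter p -> x != 0 -> poly_wot_lim p U P (op_id H) ->
  ~ poly_wot_lim p U P (op_zero H).
Proof.
move=> pP x0 /plim_wotP Pid /plim_wotP P0.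
have [r r0 xr] : exists2 r : R, 0 < r & inner H x x = r%:C.
  by apply: complex_gt0; rewrite (dnorm_gt0 (inner H)).
have r20 : 0 < r / 2 by rewrite divr_gt0.
have [y /= [yn yn']] := filter_ex (filterI (Pid x x _ r20) (P0 x x _ r20)).
move: yn'; rewrite linear0l subr0 => yn'.
have : `|inner H x x| < r%:C.
  rewrite -[inner H x x](subKr (inner H (unitary_pow U P.[(val y)%:Z] x) x)).
  apply: le_lt_trans (ler_normB _ _) _.
  by rewrite [r in ltRHS]splitr [ltRHS]rmorphD ltrD.
by rewrite xr normc_def /= expr0n addr0 sqrtr_sqr ltcR gtr0_norm// ltxx.
Qed.

(** Idempotence turns closeness of <U^P(m) x, x> to <x, x> for p-most m into
    closeness at m = y + n for some n and p-most y.  As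
    <U^P(y + n) x, x> = <U^D(y) x, U^-P(n) x>, a limit 0 for D = P(. + n) - P(n)
    would contradict it. *)
Lemma rigid_shift (p : set_system pnat) (x : H) (P : {poly int}) :
  idempotent_ultrafilter p -> x != 0 -> poly_wot_lim p U P (op_id H) ->
  exists n : pnat, ~ poly_wot_lim p U (shift_poly P (val n)%:Z) (op_zero H).
Proof.
move=> [pU pp] x0 /plim_wotP Plim.
have [r r0 xr] : exists2 r : R, 0 < r & inner H x x = r%:C.
  by apply: complex_gt0; rewrite (dnorm_gt0 (inner H)).
have r20 : 0 < r / 2 by rewrite divr_gt0.
have := Plim x x _ r20; rewrite -{1}pp => /(@filter_ex _ p)[n /= pn].
exists n => /plim_wotP/(_ x (unitary_pow U (- P.[(val n)%:Z]) x) _ r20) pn'.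
have [y /= [yn yn']] := filter_ex (filterI pn pn').
move: yn'; rewrite linear0l subr0 -unitary_pow_dot -unitary_powD.
rewrite horner_shift_poly addrC subrK -PoszD => yn'.
have : `|inner H x x| < r%:C.
  rewrite -[inner H x x](subKr (inner H (unitary_pow U P.[(val y + val n)%N%:Z] x) x)).
  apply: le_lt_trans (ler_normB _ _) _.
  by rewrite [r in ltRHS]splitr [ltRHS]rmorphD ltrD.
by rewrite xr normc_def /= expr0n addr0 sqrtr_sqr ltcR gtr0_norm// ltxx.
Qed.

End UnitaryPowers.

(** * The characterization of rigidity groups *)

(** Among the cosets of the multiples of Q two must coincide. *)
Lemma finite_index_multiple (A G : set {poly int}) : subgroup_of A G ->
  finite_index A G -> (forall P n, A P -> A (P *+ n)) ->
  forall Q, A Q -> exists2 m, (0 < m)%N & G (Q *+ m).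
Proof.
move=> [GA G0 GB] finG AM Q AQ.
pose f n : set {poly int} := [set Q *+ n + g | g in G].
have [m [n [mn fmn]]] : exists m n, (m < n)%N /\ f m = f n.
  apply: contrapT => h; apply: infinite_nat.
  have -> : [set: nat] = f @^-1` [set C | exists2 x, A x & C = [set x + g | g in G]].
    by apply/seteqP; split=> // n _; exists (Q *+ n) => //; exact: AM.
  apply: finite_preimage finG => m n _ _ fmn; apply: contrapT => mn.
  by case: (ltngtP m n) => // lt; apply: h; [exists m, n|exists n, m].
have : f n (Q *+ n) by exists 0; rewrite ?addr0.
rewrite -fmn => -[P GP e]; exists (n - m)%N; first by rewrite subn_gt0.
by rewrite mulrnBr ?(ltnW mn)// -e addrC addKr.
Qed.

Lemma intpolys_mulrn N P n : intpolys N P -> intpolys N (P *+ n).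
Proof.
move=> [P0 sP]; split; first by rewrite hornerMn P0 mul0rn.
by rewrite -scaler_nat (leq_trans (size_scale_leq _ _)).
Qed.

(** A common multiple of exponents for the monomials works for all polynomials. *)
Lemma finite_index_exponent N (G : set {poly int}) : subgroup_of (intpolys N) G ->
  finite_index (intpolys N) G ->
  exists2 d, (0 < d)%N & forall P, intpolys N P -> G (P *+ d).
Proof.
move=> hG finG; have [_ G0 GB] := hG.
have GN P : G P -> G (- P) by move=> GP; rewrite -sub0r; exact: GB.
have GD P Q : G P -> G Q -> G (P + Q).
  by move=> GP GQ; rewrite -[Q]opprK; apply: GB => //; exact: GN.
have GMn P n : G P -> G (P *+ n).
  by move=> GP; elim: n => [|n IHn]; rewrite ?mulr0n// mulrS; exact: GD.
have GMz P (q : int) : G P -> G (P *~ q).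
  by move=> GP; case: q => n; [exact: GMn|rewrite NegzE mulrNz; exact/GN/GMn].
have /choice[e eP] : forall i, exists m, (0 < m)%N /\ G (mono N i *+ m).
  move=> i; have [m m0 Gm] := finite_index_multiple hG finG
    (fun P n => @intpolys_mulrn N P n) (@intpolys_mono N i).
  by exists m.
exists (\prod_(i < N.+1) e i)%N; first by rewrite prodn_gt0// => i; have [] := eP i.
move=> P PN; rewrite (intpolys_sum PN) -sumrMnl.
elim/big_ind: _ => // i _; rewrite (bigD1 i)//= mulrnA.
apply: GMn; rewrite pmulrn mulrzAC -pmulrn; apply: GMz.
by have [] := eP i.
Qed.

(* The degree of P is (size P).-1; the hypothesis hdeg says that the maximum
   of the degrees of the elements of G is N. *)
Theorem theoremE (R : realType) (N : nat) (hN : (1 <= N)%N)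
    (G : set {poly int}) (hG : subgroup_of (intpolys N) G)
    (hdeg : (exists2 P, G P & (size P).-1 = N) /\
            (forall P, G P -> ((size P).-1 <= N)%N)) :
  rigidity_group R N G <-> finite_index (intpolys N) G.
Proof.
have [GN G0 GB] := hG.
split=> [[_ [p [H [U [p_idem GE G_zero]]]]]|finG]; last first.
  have [d d_gt0 dG] := finite_index_exponent hG finG.
  have [H [p [U [p_idem [x x0] Gid Gzero]]]] := @flow_limits R N d G d_gt0 hG dG.
  split=> //; exists p, H, U; split=> // [|Q [QN nGQ]]; last exact: Gzero.
  apply/seteqP; split=> [P GP|P [PN Pid]]; first by split; [exact: GN|exact: Gid].
  apply: contrapT => nGP; have [pU _] := p_idem.
  exact: id_zero_limits_disjoint x0 Pid (Gzero P PN nGP).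
apply: finite_index_of_degrees => //.
have [x0|x0] := pselect (exists x : H, x != 0); last first.
  (* on the zero space the operators 0 and Id coincide, so all of P_N is in G *)
  have x00 (x : H) : x = 0.
    by apply/eqP; apply: contrapT => /negP xn; apply: x0; exists x.
  have Gall P : intpolys N P -> G P.
    have [pU _] := p_idem.
    move=> PN; rewrite GE; split=> //; apply/plim_wotP => x y e e0.
    apply: filterE => n /=.
    by rewrite (x00 y) !linear0r subrr normr0 ltcR.
  move=> k kN; exists 'X^(k.+1); last by rewrite size_polyXn.
  by apply: Gall; split; [rewrite hornerXn expr0n|rewrite size_polyXn].
have [x xn0] := x0.
(* one step lowers the degree by exactly one *)
have desc j : (j < N)%N -> exists2 P, G P & size P = (N - j).+1.
  elim: j => [_|j IHj jN].
    have [[P GP sP] _] := hdeg; exists P => //.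
    by rewrite subn0 -sP prednK// lt0n; apply/eqP => s0; move: hN; rewrite -sP s0.
  have [P GP sP] := IHj (ltnW jN).
  pose k := (N - j.+1)%N.
  have k0 : (0 < k)%N by rewrite subn_gt0.
  have sPk : size P = k.+2 by rewrite sP /k subnSK// ltnW.
  have Plim : poly_wot_lim p U P (op_id H) by move: GP; rewrite GE => -[].
  have [n nlim] := rigid_shift p_idem xn0 Plim.
  have GD : G (shift_poly P (val n)%:Z).
    apply: contrapT => nG; apply: nlim; apply: G_zero; split=> //.
    exact/intpolys_shift/GN.
  exists (shift_poly P (val n)%:Z - P); first exact: GB.
  apply/eqP; rewrite eqn_leq size_shift_poly ?sPk//=.
  rewrite ltnNge; apply/negP => /leq_sizeP/(_ k (leqnn k))/eqP.
  have Pk : P`_k.+1 != 0.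
    by rewrite -[k.+1]/(k.+2.-1) -sPk -lead_coefE lead_coef_eq0 -size_poly_eq0 sPk.
  rewrite coef_shift_poly ?sPk// mulf_eq0 (negbTE Pk) mulrn_eq0 /= eqz_nat.
  by apply/negP; rewrite -lt0n; exact: valP n.
move=> k kN; have [|P GP sP] := desc (N - k.+1)%N; first by rewrite ltn_subrL hN.
by exists P => //; rewrite sP subKn.
Qed.
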